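(* Let $0\le u,v,w\le n$. If $v \geq 1$, then $$\tilde{r}^w_{u,v} = (e^{\varepsilon_{u+1}-\varepsilon_1}-1)\,\tilde{r}^{w-1}_{u-1,v-1}(\varepsilon_2,\dots,\varepsilon_{n+1}) + e^{\varepsilon_{u+1}-\varepsilon_1}\,\tilde{r}^{w-1}_{u,v-1}(\varepsilon_2,\dots,\varepsilon_{n+1}),$$ where $\tilde r^w_{u,v}=(-1)^{u+v+w}r^w_{u,v}$, $r^w_{u,v}=w_o\bigl(b^{\,n-w}_{n-u,\,n-v}\bigr)$, and $b^w_{u,v}$ are the structure constants of $K_T(\mathbb{P}^n)$ defined by $[\mathcal{O}_{X_u}][\mathcal{O}_{X_v}]=\sum_{w=0}^n b^w_{u,v}[\mathcal{O}_{X_w}]$.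
   Context: Everything is over $\mathbb{C}$. $G=SL_{n+1}$, $T=\{(t_1,\dots,t_{n+1})\in(\mathbb{C}^* )^{n+1} : \prod t_i=1\}$ is its diagonal maximal torus, acting in the obvious way on $\mathbb{P}^n$ with projective coordinates $[x_1,\dots,x_{n+1}]$. $R(T)$ is the representation ring of $T$, with $\mathbb{Z}$-basis the characters $e^\lambda$. The character $e^{\varepsilon_i}$ is $(t_1,\dots,t_{n+1})\mapsto t_i$, and $\chi_i=\varepsilon_1+\cdots+\varepsilon_i$ ($\chi_0=0$). $w_o$ is the longest element of the Weyl group of $SL_{n+1}$, acting on $R(T)$ by $w_o(e^{\varepsilon_i})=e^{\varepsilon_{n+2-i}}$. For $0\le u\le n$ let $X_u=\{[x_1,\dots,x_{u+1},0,\dots,0]\}\subset\mathbb{P}^n$. $K_T(\mathbb{P}^n)$ is the Grothendieck group of $T$-equivariant coherent sheaves (a ring, being also the Grothendieck group of $T$-equivariant vector bundles); $\{[\mathcal{O}_{X_u}]\}_{0\le u\le n}$ is an $R(T)$-basis of it. Substitution notation: it is a theorem that $$\tilde r^w_{u,v} = e^{\chi_{w}-\chi_{u}-\chi_{v}} \left[\frac{\prod_{i=1}^u (1-te^{\varepsilon_i})\prod_{i=1}^v (1-te^{\varepsilon_i})}{\prod_{i=1}^{w+1} (1-te^{\varepsilon_i})}\right]_{u+v-w},$$ where $[\,\cdot\,]_p$ is the coefficient of $t^p$ in the power series expansion at $t=0$. For weights $\mu_1,\mu_2,\dots$ of $T$, $\tilde r^w_{u,v}(\mu_1,\mu_2,\dots)\in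 R(T)$ denotes the element obtained from this expression by replacing each $\varepsilon_i$ by $\mu_i$. Thus $\tilde r^{w-1}_{a,b}(\varepsilon_2,\dots,\varepsilon_{n+1})$ is obtained from the displayed formula for $\tilde r^{w-1}_{a,b}$ by replacing $\varepsilon_i$ with $\varepsilon_{i+1}$. Convention: $\tilde r^w_{u,v}=0$ if $u$, $v$ or $w$ is negative. *)

(* Defs.v *)
From HB Require Import structures.
From mathcomp Require Import all_boot all_order all_algebra.
From mathcomp Require Import finmap.
From mathcomp.multinomials Require Import monalg.
From mathcomp Require Import reals.
From mathcomp.real_closed Require Import complex.

Set Implicit Arguments.
Unset Strict Implicit.
Unset Printing Implicit Defensive.

Import Order.TTheory GRing.Theory Num.Theory.
Local Open Scope quotient_scope.
Local Open Scope ring_scope.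

(* The integral group ring Z[X] of an abelian group X written additively.
   The ring structure of [monalg] does not apply, since it requires a monoid
   without nontrivial units. *)
Section GroupRing.
Variable X : zmodType.

Definition grpring := {malg int[X]}.
HB.instance Definition _ := GRing.Zmodule.on grpring.

Implicit Types (g h : grpring).

Definition grmul g h : grpring :=
  \sum_(x <- msupp g) \sum_(y <- msupp h) << g@_x * h@_y *g (x + y)%R >>.

Definition grone : grpring := << 1 *g (0 : X) >>.

Lemma grmulw (d1 d2 : {fset X}) g h :
  (msupp g `<=` d1)%fset -> (msupp h `<=` d2)%fset ->
  grmul g h = \sum_(x <- d1) \sum_(y <- d2) << g@_x * h@_y *g (x + y)%R >>.
Proof.
move=> le_d1 le_d2; rewrite /grmul (big_fset_incl _ le_d1) /=.
  apply/eq_bigr=> k1 _; apply/big_fset_incl => // k _ /mcoeff_outdom ->.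
  by rewrite mulr0 monalgU0.
move=> k _ /mcoeff_outdom g1k.
by rewrite big1 => // k' _; rewrite g1k mul0r monalgU0.
Qed.

Lemma grmulC : commutative grmul.
Proof.
move=> g h; rewrite /grmul exchange_big /=.
by apply: eq_bigr => y _; apply: eq_bigr => x _; rewrite mulrC addrC.
Qed.

Lemma grmul0g : left_zero 0 grmul.
Proof. by move=> g; rewrite /grmul msupp0 big_seq_fset0. Qed.

Lemma grmulDl : left_distributive grmul +%R.
Proof.
move=> g1 g2 g.
rewrite (grmulw (msuppD_le g1 g2) (fsubset_refl _)).
rewrite (grmulw (fsubsetUl _ (msupp g2)) (fsubset_refl (msupp g))).
rewrite (grmulw (fsubsetUr (msupp g1) _) (fsubset_refl (msupp g))).
rewrite -big_split /=; apply/eq_bigr=> k1 _.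
rewrite -big_split /=; apply/eq_bigr=> k2 _.
by rewrite mcoeffD mulrDl monalgUD.
Qed.

Lemma grmulDr : right_distributive grmul +%R.
Proof. by move=> g h1 h2; rewrite !(grmulC g) grmulDl. Qed.

Lemma grmulUU (c1 c2 : int) (k1 k2 : X) :
  grmul << c1 *g k1 >> << c2 *g k2 >> = << c1 * c2 *g (k1 + k2)%R >>.
Proof. by rewrite (grmulw msuppU_le msuppU_le) !big_seq_fset1 !mcoeffUU. Qed.

Lemma grmul1g : left_id grone grmul.
Proof.
move=> g; rewrite (grmulw msuppU_le (fsubset_refl _)) big_seq_fset1.
rewrite [RHS]monalgE; apply/eq_bigr => k _.
by rewrite mcoeffUU mul1r add0r.
Qed.

Lemma grind (P : grpring -> Prop) :
  P 0 -> (forall g h, P g -> P h -> P (g + h)) ->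
  (forall c k, P << c *g k >>) -> forall g, P g.
Proof.
move=> P0 PD PU g; rewrite [g]monalgE.
by elim/big_rec: _ => // k h _; apply: PD; apply: PU.
Qed.

Lemma grmulA : associative grmul.
Proof.
have grmulg0 g : grmul g 0 = 0 by rewrite grmulC grmul0g.
move=> f g h; elim/grind: f => [|f1 f2 e1 e2|c1 k1].
- by rewrite !grmul0g.
- by rewrite !grmulDl e1 e2.
elim/grind: g => [|g1 g2 e1 e2|c2 k2].
- by rewrite grmulg0 !grmul0g grmulg0.
- by rewrite grmulDl !grmulDr e1 e2 grmulDl.
elim/grind: h => [|h1 h2 e1 e2|c3 k3].
- by rewrite !grmulg0.
- by rewrite !grmulDr e1 e2.
by rewrite !grmulUU mulrA addrA.
Qed.

Lemma grone_neq0 : grone != 0.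
Proof. by rewrite monalgU_eq0 oner_eq0. Qed.

HB.instance Definition _ := GRing.Zmodule_isComNzRing.Build grpring
  grmulA grmulC grmul1g grmulDl grone_neq0.

Definition grexp (x : X) : grpring := << 1 *g x >>.

End GroupRing.

Section WeightLattice.
Variable n : nat.

(* [expo] is the character lattice of the diagonal torus of GL_(n+1); it also
   indexes the Laurent monomials in the n+1 projective coordinates. *)
Local Notation expo := {ffun 'I_n.+1 -> int}.

Definition diagonal : {pred expo} :=
  [pred a : expo | [forall i, a i == a ord0]].

Fact diagonal_zmod_closed : zmod_closed diagonal.
Proof.
split=> [|a b /forallP ha /forallP hb].
  by apply/forallP => i; rewrite !ffunE.
by apply/forallP => i; rewrite !ffunE (eqP (ha i)) (eqP (hb i)).
Qed.
HB.instance Definition _ :=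
  GRing.isZmodClosed.Build expo diagonal diagonal_zmod_closed.

(* X(T): the product of the t_i is 1 on T. *)
Definition weight : zmodType := Quotient.quot diagonal.

Definition RT := grpring weight.

Definition wt (a : expo) : weight := \pi_weight a.

(* epsilon_i, numbered from 1 *)
Definition eps (i : nat) : weight :=
  wt [ffun j : 'I_n.+1 => (j.+1 == i)%:Z].

Definition wo_weight (x : weight) : weight :=
  wt [ffun i => repr x (rev_ord i)].

Definition wo (g : RT) : RT :=
  \sum_(x <- msupp g) << g@_x *g wo_weight x >>.

End WeightLattice.

Section PowerSeries.
Variable A : comNzRingType.

(* The power series with p-th coefficient f p. *)
Definition pseries := nat -> A.
Definition psone : pseries := fun p => (p == 0)%:R.
Definition psmul (f g : pseries) : pseries :=
  fun p => \sum_(i < p.+1) f i * g (p - i)%N.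
(* 1 - t x *)
Definition pslin (x : A) : pseries := fun p => (p == 0)%:R - x *+ (p == 1).
(* 1 / (1 - t x) *)
Definition psgeom (x : A) : pseries := fun p => x ^+ p.

Lemma pslinK x p : psmul (pslin x) (psgeom x) p = psone p.
Proof.
rewrite /psmul big_ord_recl /pslin /psgeom /= subn0 mulr0n subr0 mul1r.
case: p => [|p]; first by rewrite big_ord0 addr0.
rewrite big_ord_recl /= big1 => [|i _]; last by rewrite /= subrr mul0r.
by rewrite addr0 sub0r mulr1n subn1 mulNr -exprS subrr.
Qed.

End PowerSeries.

(* The closed formula for r~^w_{u,v}, with mu i substituted for epsilon_i. *)
Section ClosedFormula.
Variables (n : nat) (mu : nat -> weight n).

Definition chi (k : nat) : weight n := \sum_(1 <= i < k.+1) mu i.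

Definition pslins (u : nat) : pseries (RT n) :=
  \big[@psmul (RT n)/@psone (RT n)]_(1 <= i < u.+1) pslin (grexp (mu i)).

Definition psgeoms (u : nat) : pseries (RT n) :=
  \big[@psmul (RT n)/@psone (RT n)]_(1 <= i < u.+1) psgeom (grexp (mu i)).

Definition rtilde_formula (u v w : int) : RT n :=
  match u, v, w with
  | Posz u, Posz v, Posz w =>
      if (w <= u + v)%N then
        grexp (chi w - chi u - chi v)
        * psmul (psmul (pslins u) (pslins v)) (psgeoms w.+1) (u + v - w)%N
      else 0
  | _, _, _ => 0
  end.

End ClosedFormula.

Section LinearMaps.
Variable K : fieldType.

Lemma lin0 (V W : lmodType K) (f : V -> W) : linear f -> f 0 = 0.
Proof.
by move=> lf; have := lf (-1) 0 0; rewrite !scaleN1r oppr0 addr0 addNr.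
Qed.

Lemma linZ (V W : lmodType K) (f : V -> W) c v :
  linear f -> f (c *: v) = c *: f v.
Proof. by move=> lf; have := lf c v 0; rewrite (lin0 lf) !addr0. Qed.

Lemma lin_comp (U V W : lmodType K) (f : V -> W) (g : U -> V) :
  linear f -> linear g -> linear (f \o g).
Proof. by move=> lf lg c x y /=; rewrite lg lf. Qed.

Lemma lin_scale (V W : lmodType K) (f : V -> W) c :
  linear f -> linear (fun v => c *: f v).
Proof. by move=> lf d x y; rewrite lf scalerDr !scalerA mulrC. Qed.

End LinearMaps.

(* Linear extension of a map defined on a basis. *)
Section FreeModule.
Variables (K : fieldType) (S : choiceType) (V : lmodType K).

Definition mlift (f : S -> V) (g : {malg K[S]}) : V :=
  \sum_(k <- msupp g) g@_k *: f k.

Lemma mliftw (f : S -> V) (g : {malg K[S]}) (d : {fset S}) :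
  (msupp g `<=` d)%fset -> mlift f g = \sum_(k <- d) g@_k *: f k.
Proof.
move=> le_d; apply: (big_fset_incl _ le_d) => k _ /mcoeff_outdom ->.
by rewrite scale0r.
Qed.

Lemma mlift_linear f : linear (mlift f).
Proof.
move=> c g h.
set d := (msupp g `|` msupp h)%fset.
have dg : (msupp g `<=` d)%fset by rewrite fsubsetUl.
have dh : (msupp h `<=` d)%fset by rewrite fsubsetUr.
have dgh : (msupp (c *: g + h) `<=` d)%fset.
  apply: fsubset_trans (msuppD_le _ _) _; rewrite fsubUset dh andbT.
  exact: fsubset_trans (msuppZ_le _ _) dg.
rewrite (mliftw f dg) (mliftw f dh) (mliftw f dgh) scaler_sumr -big_split /=.
by apply: eq_bigr => k _; rewrite mcoeffD mcoeffZ scalerDl scalerA.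
Qed.

Lemma mliftU f k : mlift f << 1 *g k >> = f k.
Proof. by rewrite (mliftw f msuppU_le) big_seq_fset1 mcoeffUU scale1r. Qed.

Lemma malgUZ (c : K) (k : S) : << c *g k >> = c *: << 1 *g k >> :> {malg K[S]}.
Proof. by apply/malgP => k'; rewrite mcoeffZ !mcoeffU mulrnAr mulr1. Qed.

Lemma eq_linear_malg (f g : {malg K[S]} -> V) :
  linear f -> linear g -> (forall k, f << 1 *g k >> = g << 1 *g k >>) -> f =1 g.
Proof.
move=> lf lg fg.
move=> m; rewrite [m]monalgE; elim: (enum_fset _) => [|k s IH].
  by rewrite big_nil !lin0.
by rewrite big_cons malgUZ lf lg fg IH.
Qed.

End FreeModule.

Section ProjectiveSpace.
Variables (C : fieldType) (n : nat).
Local Notation expo := {ffun 'I_n.+1 -> int}.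

Definition torus : {pred {ffun 'I_n.+1 -> C}} :=
  [pred t : {ffun 'I_n.+1 -> C} | \prod_i t i == 1].
Definition tpow (t : {ffun 'I_n.+1 -> C}) (a : expo) : C := \prod_i t i ^ a i.

(* I stands for the T-stable affine open U_I of points whose coordinates
   indexed by I are nonzero; these opens are stable under intersection and
   cover P^n. *)
Record opens := Opens { oset :> {set 'I_n.+1}; _ : oset != set0 }.

(* The monomials x^a forming a basis of the ring of functions on U_I. *)
Definition regular (I : {set 'I_n.+1}) (a : expo) : bool :=
  (\sum_i a i == 0) && [forall j, (j \notin I) ==> (0 <= a j)].

Implicit Types I J K : opens.

(* A T-equivariant quasi-coherent sheaf on P^n, given by its sections over the
   U_I. Over U_I these form a module over O(U_I), i.e. a C-vector space with a
   linear action [xact] of the monoid of monomials of O(U_I), together with a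
   rational linear action [tact] of T. A function is moved by T through
   (t.f)(x) = f(t^-1 x), so x^a has weight -a. For U_J contained in U_I,
   restriction has to be the localization inverting the monomials of O(U_I)
   that are invertible on U_J. *)
Record eqsheaf := EqSheaf {
  sec : opens -> lmodType C;
  xact : forall I, expo -> sec I -> sec I;
  tact : forall I, {ffun 'I_n.+1 -> C} -> sec I -> sec I;
  res : forall I J, sec I -> sec J;
  xact_linear : forall I a, regular I a -> linear (@xact I a);
  xact0 : forall I m, @xact I 0 m = m;
  xactD : forall I a b m, regular I a -> regular I b ->
    @xact I (a + b) m = xact a (xact b m);
  tact_linear : forall I t, torus t -> linear (@tact I t);
  tact1 : forall I m, @tact I [ffun=> 1] m = m;
  tactM : forall I s t m, torus s -> torus t ->
    @tact I [ffun i => s i * t i] m = tact s (tact t m);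
  tact_rational : forall I (m : sec I), exists s : seq (expo * sec I),
    (forall p, p \in s -> forall t, torus t -> tact t p.2 = tpow t p.1 *: p.2)
    /\ m = \sum_(p <- s) p.2;
  tact_xact : forall I t a m, torus t -> regular I a ->
    @tact I t (xact a m) = tpow t (- a) *: xact a (tact t m);
  res_linear : forall I J : opens, oset I \subset oset J -> linear (@res I J);
  res_id : forall I m, @res I I m = m;
  res_comp : forall (I J K : opens) m,
    oset I \subset oset J -> oset J \subset oset K ->
    @res I K m = res K (@res I J m);
  res_xact : forall (I J : opens) a m, oset I \subset oset J -> regular I a ->
    @res I J (xact a m) = xact a (res J m);
  res_tact : forall (I J : opens) t m, oset I \subset oset J -> torus t ->
    @res I J (tact t m) = tact t (res J m);
  res_ker : forall (I J : opens) m, oset I \subset oset J -> @res I J m = 0 ->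
    exists a, [/\ regular I a, regular J (- a) & xact a m = 0];
  res_loc : forall (I J : opens) (m : sec J), oset I \subset oset J ->
    exists a m', [/\ regular I a, regular J (- a) & @res I J m' = xact a m]
}.

Lemma regular0 (I : {set 'I_n.+1}) : regular I 0.
Proof.
apply/andP; split; first by rewrite big1 // => i _; rewrite ffunE.
by apply/forallP => j; rewrite ffunE lexx implybT.
Qed.

Lemma regularD (I : {set 'I_n.+1}) a b : regular I a -> regular I b -> regular I (a + b).
Proof.
move=> /andP[/eqP sa /forallP pa] /andP[/eqP sb /forallP pb].
apply/andP; split.
  rewrite (eq_bigr (fun i => a i + b i)) => [|i _]; last by rewrite ffunE.
  by rewrite big_split /= sa sb addr0.
apply/forallP => j; apply/implyP => jI; rewrite ffunE addr_ge0 //.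
  exact: (implyP (pa j)).
exact: (implyP (pb j)).
Qed.

Lemma regularS (I J : {set 'I_n.+1}) a :
  I \subset J -> regular I a -> regular J a.
Proof.
move=> sIJ /andP[sa /forallP pa]; rewrite /regular sa.
apply/forallP => j; apply/implyP => jJ; apply: (implyP (pa j)).
by apply: contra jJ; apply: (subsetP sIJ).
Qed.

Lemma torus_neq0 t i : torus t -> t i != 0.
Proof.
move=> /eqP pt; apply/eqP => ti.
by move: pt; rewrite (bigD1 i) //= ti mul0r => /eqP; rewrite eq_sym oner_eq0.
Qed.

Lemma tpow0 t : tpow t 0 = 1.
Proof. by rewrite /tpow big1 // => i _; rewrite ffunE expr0z. Qed.

Lemma tpowD t a b : torus t -> tpow t (a + b) = tpow t a * tpow t b.
Proof.
move=> tt; rewrite /tpow -big_split /=; apply: eq_bigr => i _.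
by rewrite ffunE expfzDr // torus_neq0.
Qed.

Lemma tpow1 a : tpow [ffun=> 1] a = 1.
Proof. by rewrite /tpow big1 // => i _; rewrite ffunE exp1rz. Qed.

Lemma tpowM (s t : {ffun 'I_n.+1 -> C}) a : tpow [ffun i => s i * t i] a = tpow s a * tpow t a.
Proof.
by rewrite /tpow -big_split /=; apply: eq_bigr => i _; rewrite ffunE expfzMl.
Qed.

(* The structure sheaf of X_u = {x_j = 0 for j > u}, coordinates being numbered
   from 0. Over U_I it is the quotient of O(U_I) by the ideal generated by the
   monomials involving some x_j with j > u; [xmon] are the other monomials. *)
Section StructureSheaf.
Variable u : 'I_n.+1.

Definition xmon (I : {set 'I_n.+1}) (a : expo) : bool :=
  regular I a && [forall j : 'I_n.+1, (u < j)%N ==> (j \notin I) && (a j == 0)].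

Definition osec (I : opens) : lmodType C := {malg C[{a : expo | xmon I a}]}.

(* The class of the monomial x^a in the quotient. *)
Definition omon (I : opens) (a : expo) : osec I :=
  if insub a is Some s then << 1 *g s >> else 0.

Definition oxact (I : opens) (b : expo) : osec I -> osec I :=
  mlift (fun a => omon I (val a + b)).
Definition otact (I : opens) (t : {ffun 'I_n.+1 -> C}) : osec I -> osec I :=
  mlift (fun a => tpow t (- val a) *: omon I (val a)).
Definition ores (I J : opens) : osec I -> osec J :=
  mlift (fun a => omon J (val a)).

Lemma omonE (I : opens) (s : {a : expo | xmon I a}) : << 1 *g s >> = omon I (val s).
Proof. by rewrite /omon valK. Qed.
Lemma osum I (m : osec I) : m = \sum_(k <- msupp m) m@_k *: omon I (val k).
Proof.
by rewrite {1}[m]monalgE; apply: eq_bigr => k _; rewrite -omonE -malgUZ.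
Qed.
Lemma omonF (I : opens) a : ~~ xmon I a -> omon I a = 0.
Proof. by move=> h; rewrite /omon insubN. Qed.
Lemma omon_lift (I : opens) (V : lmodType C) (f : expo -> V) a : xmon I a ->
  mlift (fun s : {a : expo | xmon I a} => f (val s)) (omon I a) = f a.
Proof. by move=> h; rewrite /omon insubT mliftU. Qed.

Lemma xmonD (I : opens) a b : regular I a -> regular I b ->
  xmon I (a + b) -> xmon I a.
Proof.
move=> ra rb /andP[_ /forallP h]; rewrite /xmon ra; apply/forallP => j.
apply/implyP => uj; have /andP[jI] := implyP (h j) uj.
rewrite ffunE jI /=; move: ra rb => /andP[_ /forallP/(_ j)] + /andP[_ /forallP/(_ j)].
by rewrite jI /= => a0 b0; rewrite paddr_eq0 // => /andP[].
Qed.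

Let lx I b : linear (@oxact I b). Proof. exact: mlift_linear. Qed.
Let lt I t : linear (@otact I t). Proof. exact: mlift_linear. Qed.
Let lr I J : linear (@ores I J). Proof. exact: mlift_linear. Qed.

Lemma oxact_omon (I : opens) a b : regular I a -> regular I b ->
  oxact b (omon I a) = omon I (a + b).
Proof.
move=> ra rb; case: (boolP (xmon I a)) => xa; first exact: (omon_lift (fun a => omon I (a + b))).
rewrite (omonF xa) (lin0 (@lx _ _)) omonF //.
by apply: contra xa; apply: xmonD.
Qed.

Lemma otact_omon (I : opens) a t :
  otact t (omon I a) = tpow t (- a) *: omon I a.
Proof.
case: (boolP (xmon I a)) => xa.
  exact: (omon_lift (fun a => tpow t (- a) *: omon I a)).
by rewrite (omonF xa) (lin0 (@lt _ _)) scaler0.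
Qed.

Lemma xmonS (I J : opens) a : oset I \subset oset J -> regular I a -> xmon J a -> xmon I a.
Proof.
move=> sIJ ra /andP[_ /forallP h]; rewrite /xmon ra; apply/forallP => j.
apply/implyP => uj; have /andP[jJ ->] := implyP (h j) uj; rewrite andbT.
by apply: contra jJ; apply: (subsetP sIJ).
Qed.

Lemma ores_omon (I J : opens) a : oset I \subset oset J -> regular I a ->
  ores J (omon I a) = omon J a.
Proof.
move=> sIJ ra; case: (boolP (xmon I a)) => xa; first exact: (omon_lift (fun a => omon J a)).
rewrite (omonF xa) (lin0 (@lr _ _)) omonF //.
by apply: contra xa; apply: xmonS.
Qed.

Let oext (I : opens) (V : lmodType C) (f g : osec I -> V) :
  linear f -> linear g -> (forall a, xmon I a -> f (omon I a) = g (omon I a)) ->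
  f =1 g.
Proof.
move=> lf lg fg; apply: eq_linear_malg => // k.
by rewrite omonE fg //; apply: (valP k).
Qed.

Let xreg (I : opens) a : xmon I a -> regular I a. Proof. by case/andP. Qed.
Let lid (V : lmodType C) : linear (fun v : V => v). Proof. by []. Qed.

Local Opaque omon oxact otact ores.

Fact oxact_linear I a : regular (oset I) a -> linear (@oxact I a).
Proof. by move=> _; apply: lx. Qed.

Fact oxact0 I m : @oxact I 0 m = m.
Proof.
apply: (oext (@lx _ _) (@lid _)) => a /xreg ra.
by rewrite oxact_omon ?addr0 // regular0.
Qed.

Fact oxactD (I : opens) a b m : regular I a -> regular I b ->
  @oxact I (a + b) m = oxact a (oxact b m).
Proof.
move=> ra rb.
apply: (oext (@lx _ _) (lin_comp (@lx _ _) (@lx _ _))).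
move=> c /xreg rc /=.
rewrite !oxact_omon ?regularD //.
by rewrite (addrC a) addrA.
Qed.

Fact otact_linear I t : torus t -> linear (@otact I t).
Proof. by move=> _; apply: lt. Qed.

Fact otact1 I m : @otact I [ffun=> 1] m = m.
Proof.
apply: (oext (@lt _ _) (@lid _)) => a /xreg ra.
by rewrite otact_omon tpow1 scale1r.
Qed.

Fact otactM I s t m : torus s -> torus t ->
  @otact I [ffun i => s i * t i] m = otact s (otact t m).
Proof.
move=> ts tt.
apply: (oext (@lt _ _) (lin_comp (@lt _ _) (@lt _ _))).
move=> c /xreg rc /=; rewrite !otact_omon.
by rewrite (linZ (tpow t (- c)) (omon I c) (otact_linear ts)) otact_omon scalerA tpowM mulrC.
Qed.

Fact otact_rational I (m : osec I) : exists s : seq (expo * osec I),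
  (forall p, p \in s -> forall t, torus t -> otact t p.2 = tpow t p.1 *: p.2)
  /\ m = \sum_(p <- s) p.2.
Proof.
exists [seq (- val k, m@_k *: omon I (val k)) | k <- enum_fset (msupp m)]; split.
  move=> _ /mapP[k _ ->] t tt; rewrite [_.2]/= [_.1]/=.
  by rewrite (linZ (m@_k) (omon I (val k)) (otact_linear tt)) otact_omon !scalerA mulrC.
by rewrite big_map {1}(osum m).
Qed.

Fact otact_xact (I : opens) t a m : torus t -> regular I a ->
  @otact I t (oxact a m) = tpow t (- a) *: oxact a (otact t m).
Proof.
move=> tt ra.
apply: (oext (lin_comp (otact_linear tt) (oxact_linear ra))
  (lin_scale _ (lin_comp (oxact_linear ra) (otact_linear tt)))).
move=> b /xreg rb /=; rewrite (otact_omon I b).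
rewrite (linZ (tpow t (- b)) (omon I b) (oxact_linear ra)).
rewrite (oxact_omon rb ra) (otact_omon I (b + a)) scalerA.
by rewrite opprD (tpowD (- b) (- a) tt) mulrC.
Qed.

Fact ores_linear (I J : opens) : oset I \subset oset J -> linear (@ores I J).
Proof. by move=> _; apply: lr. Qed.

Fact ores_id I m : @ores I I m = m.
Proof.
apply: (oext (@lr _ _) (@lid _)) => a /xreg ra.
by rewrite ores_omon.
Qed.

Fact ores_comp (I J K : opens) m :
  oset I \subset oset J -> oset J \subset oset K ->
  @ores I K m = ores K (@ores I J m).
Proof.
move=> sIJ sJK; have sIK := subset_trans sIJ sJK.
apply: (oext (ores_linear sIK) (lin_comp (ores_linear sJK) (ores_linear sIJ))).
move=> a /xreg ra /=; rewrite !ores_omon //; exact: regularS ra.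
Qed.

Fact ores_xact (I J : opens) a m : oset I \subset oset J -> regular I a ->
  @ores I J (oxact a m) = oxact a (ores J m).
Proof.
move=> sIJ ra; have raJ := regularS sIJ ra.
apply: (oext (lin_comp (ores_linear sIJ) (oxact_linear ra))
   (lin_comp (oxact_linear raJ) (ores_linear sIJ))).
move=> b /xreg rb /=; have rbJ := regularS sIJ rb.
by rewrite oxact_omon // !ores_omon ?oxact_omon // regularD.
Qed.

Fact ores_tact (I J : opens) t m : oset I \subset oset J -> torus t ->
  @ores I J (otact t m) = otact t (ores J m).
Proof.
move=> sIJ tt.
apply: (oext (lin_comp (ores_linear sIJ) (otact_linear tt))
   (lin_comp (otact_linear tt) (ores_linear sIJ))).
move=> b /xreg rb /=; rewrite otact_omon.
rewrite (linZ (tpow t (- b)) (omon I b) (ores_linear sIJ)).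
by rewrite !ores_omon // otact_omon.
Qed.

Let dlt (i j : 'I_n.+1) : expo :=
  [ffun k => (k == j)%:R - (k == i)%:R].

Let sum_dlt i j : \sum_k dlt i j k = 0.
Proof.
rewrite (eq_bigr (fun k => (k == j)%:R - (k == i)%:R)) => [|k _]; last by rewrite ffunE.
have d l : \sum_(k < n.+1) (k == l)%:R = 1 :> int.
  by rewrite (bigD1 l) //= eqxx big1 ?addr0 // => k /negbTE ->.
by rewrite sumrB !d subrr.
Qed.

Let dlt_reg (I : {set 'I_n.+1}) i j : i \in I -> regular I (dlt i j).
Proof.
move=> iI; rewrite /regular sum_dlt eqxx; apply/forallP => k; apply/implyP => kI.
rewrite ffunE; have [ki|_] := eqVneq k i; first by rewrite ki iI in kI.
by rewrite subr0 ler0n.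
Qed.

Let dlt_opp i j : - dlt i j = dlt j i.
Proof. by apply/ffunP => k; rewrite !ffunE opprB. Qed.

Fact ores_ker (I J : opens) m : oset I \subset oset J -> @ores I J m = 0 ->
  exists a, [/\ regular I a, regular J (- a) & oxact a m = 0].
Proof.
move=> sIJ; case: (boolP [exists j : 'I_n.+1, (u < j)%N && (j \in oset J)]).
  move=> /existsP[j /andP[uj jJ]] _; have [i iI] : exists i, i \in oset I.
    by apply/set0Pn; case: (I).
  exists (dlt i j); rewrite dlt_opp !dlt_reg //; split=> //.
  apply: (oext (oxact_linear (dlt_reg j iI)) (g := fun=> 0)).
    by move=> c x y; rewrite scaler0 addr0.
  move=> b xb; rewrite oxact_omon ?dlt_reg ?(xreg xb) // omonF //.
  rewrite negb_and orbC; apply/orP; left; apply/forallPn; exists j.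
  rewrite uj /= negb_and negbK; apply/orP.
  move: xb => /andP[_ /forallP/(_ j)]; rewrite uj /= => /andP[jI /eqP bj]; right.
  rewrite !ffunE bj eqxx add0r; have [ji|_] := eqVneq j i; first by rewrite ji iI in jI.
  by [].
rewrite negb_exists => /forallP hJ m0; exists 0.
rewrite oppr0 !regular0 oxact0; split=> //.
have xIJ a : xmon I a -> xmon J a.
  move=> /andP[ra /forallP h]; rewrite /xmon (regularS sIJ ra).
  apply/forallP => j; apply/implyP => uj; have := hJ j; rewrite uj /= => ->.
  by have /andP[_ ->] := implyP (h j) uj.
pose g : osec J -> osec I := mlift (fun a => omon I (val a)).
have lg : linear g by apply: mlift_linear.
have -> : m = g (ores J m).
  apply: (oext (@lid _) (lin_comp lg (ores_linear sIJ))) => a xa /=.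
  rewrite ores_omon ?(xreg xa) // /g.
  by rewrite (omon_lift (fun a => omon I a)) // xIJ.
by rewrite m0 lin0.
Qed.

Fact ores_loc (I J : opens) (m : osec J) : oset I \subset oset J ->
  exists a m', [/\ regular I a, regular J (- a) & @ores I J m' = oxact a m].
Proof.
move=> sIJ; rewrite [m]osum; elim: (enum_fset _) => [|k s [a [m1 [ra rna e]]]].
  exists 0, 0; rewrite oppr0 !regular0 big_nil; split=> //.
  by rewrite (lin0 (ores_linear sIJ)) (lin0 (oxact_linear (regular0 _))).
have [i iI] : exists i, i \in oset I by apply/set0Pn; case: (I).
have iJ := subsetP sIJ i iI.
set b := val k; have xb : xmon J b := valP k.
pose N : nat := (\sum_j `|b j|)%N.
pose c : expo := \sum_(j in oset J) dlt i j *+ N.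
have rc : regular I c.
  rewrite /c; elim/big_ind: _ => [||j _]; [exact: regular0|exact: regularD|].
  elim: (N) => [|l IH]; rewrite ?mulr0n ?regular0 // mulrS regularD ?dlt_reg //.
have rnc : regular J (- c).
  rewrite /c -sumrN; elim/big_ind: _ => [||j jJ]; [exact: regular0|exact: regularD|].
  rewrite -mulNrn dlt_opp.
  elim: (N) => [|l IH]; rewrite ?mulr0n ?regular0 // mulrS regularD ?dlt_reg //.
have cE j : j != i -> c j = ((j \in oset J) * N)%:R.
  move=> ji; rewrite /c sum_ffunE.
  have dE l : (dlt i l *+ N) j = if j == l then N%:R else 0.
    by rewrite ffunMnE ffunE (negbTE ji) subr0; case: eqP; rewrite ?mul0rn.
  under eq_bigr do rewrite dE.
  rewrite -big_mkcondr /=; case: (boolP (j \in oset J)) => jJ.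
    rewrite (big_pred1 j) ?mul1n // => l /=; rewrite eq_sym.
    by case: eqP => [->|_]; rewrite ?jJ ?andbF.
  rewrite big_pred0 // => l; case: eqP => [<-|_]; rewrite ?andbF //.
  by rewrite (negbTE jJ).
have xcb : xmon I (b + c).
  have rcb : regular J (b + c) by rewrite regularD ?(xreg xb) // (regularS sIJ).
  apply/andP; split.
    apply/andP; split; first by case/andP: rcb.
    apply/forallP => j; apply/implyP => jI.
    have ji : j != i by apply: contraNneq jI => ->.
    rewrite ffunE cE //; case: (boolP (j \in oset J)) => jJ.
      rewrite mul1n -lerBlDl sub0r natz.
      apply: le_trans (ler_norm _) _; rewrite normrN.
      by rewrite -abszE lez_nat /N (bigD1 j) //= leq_addr.
    rewrite mul0n addr0; move: (xreg xb) => /andP[_ /forallP/(_ j)].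
    by rewrite jJ.
  apply/forallP => j; apply/implyP => uj.
  have /andP[_ /forallP/(_ j)] := xb; rewrite uj /= => /andP[jJ /eqP bj].
  have jI : j \notin oset I by apply: contra jJ; apply: (subsetP sIJ).
  have ji : j != i by apply: contraNneq jI => ->.
  by rewrite jI ffunE bj cE // (negbTE jJ) mul0n.
have raJ := regularS sIJ ra; have rcJ := regularS sIJ rc.
exists (a + c), (m@_k *: oxact a (omon I (b + c)) + oxact c m1).
split; [exact: regularD|by rewrite opprD; apply: regularD|].
have e1 : ores J (oxact a (omon I (b + c))) = oxact (a + c) (omon J b).
  rewrite (oxact_omon (xreg xcb) ra) (oxact_omon (xreg xb) (regularD raJ rcJ)).
  rewrite (ores_omon sIJ (regularD (xreg xcb) ra)).
  by rewrite -addrA (addrC c).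
set m2 := \sum_(l <- s) _ in e *.
have e2 : ores J (oxact c m1) = oxact (a + c) m2.
  have -> : a + c = c + a by exact: addrC.
  have h1 := ores_xact m1 sIJ rc.
  have h2 := congr1 (@oxact J c) e.
  have h3 := oxactD m2 rcJ raJ.
  rewrite h1 h2 h3; reflexivity.
have h := ores_linear sIJ (m@_k) (oxact a (omon I (b + c))) (oxact c m1).
have h' := oxact_linear (regularD raJ rcJ) (m@_k) (omon J b) m2.
have e3 := congr2 (fun x y => m@_k *: x + y) e1 e2.
rewrite big_cons -/m2 -/b h' -e3; exact h.
Qed.

Definition OXsheaf : eqsheaf := EqSheaf oxact_linear oxact0 oxactD
  otact_linear otact1 otactM otact_rational otact_xact
  ores_linear ores_id ores_comp ores_xact ores_tact ores_ker ores_loc.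

End StructureSheaf.

(* O(U_I), as P^n = X_n. *)
Definition regfun (I : opens) : lmodType C := sec (OXsheaf ord_max) I.

Definition funact (F : eqsheaf) (I : opens) (f : regfun I) (m : sec F I) : sec F I :=
  mlift (fun a : {a : expo | xmon ord_max I a} => xact (val a) m) f.

Definition coherent (F : eqsheaf) : Prop :=
  forall I, exists r (g : 'I_r -> sec F I),
    forall m, exists f : 'I_r -> regfun I, m = \sum_i funact (f i) (g i).

(* Locally free of finite rank: every F(U_I) is a finitely generated projective
   O(U_I)-module, i.e. has a finite dual basis (g, phi). *)
Definition locally_free (F : eqsheaf) : Prop :=
  forall I, exists r (g : 'I_r -> sec F I) (phi : 'I_r -> sec F I -> regfun I),
    [/\ forall i, linear (phi i),
        forall i a m, regular I a -> phi i (xact a m) = xact a (phi i m)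
      & forall m, m = \sum_i funact (phi i m) (g i)].

Record morphism (F G : eqsheaf) := Morphism {
  mor : forall I, sec F I -> sec G I;
  mor_linear : forall I, linear (@mor I);
  mor_xact : forall I a m, regular (oset I) a -> @mor I (xact a m) = xact a (mor m);
  mor_tact : forall I t m, torus t -> @mor I (tact t m) = tact t (mor m);
  mor_res : forall (I J : opens) m, oset I \subset oset J ->
    @mor J (@res F I J m) = res J (mor m)
}.

Definition short_exact (F' F F'' : eqsheaf) : Prop :=
  exists (f : morphism F' F) (g : morphism F F''), forall I : opens,
    [/\ injective (@mor _ _ f I),
        forall m, (@mor _ _ g I m = 0) <-> (exists m', mor f m' = m)
      & forall m'', exists m, @mor _ _ g I m = m''].

(* H is the tensor product of E and F over O: each H(U_I) is the tensor product
   of the modules of sections over O(U_I). *)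
Definition is_tensor (E F H : eqsheaf) : Prop :=
  exists beta : forall I, sec E I -> sec F I -> sec H I,
    [/\ forall I, (forall m, linear (beta I m)) /\ (forall m', linear (beta I ^~ m')),
        forall (I : opens) a m m', regular I a ->
          beta I (xact a m) m' = xact a (beta I m m')
          /\ beta I m (xact a m') = xact a (beta I m m'),
        forall I t m m', torus t ->
          tact t (beta I m m') = beta I (tact t m) (tact t m'),
        forall (I J : opens) m m', oset I \subset oset J ->
          res J (beta I m m') = beta J (res J m) (res J m')
      & forall (I : opens) (V : lmodType C) (gamma : sec E I -> sec F I -> V),
          (forall m, linear (gamma m)) -> (forall m, linear (gamma ^~ m)) ->
          (forall a m m', regular I a ->
             gamma (xact a m) m' = gamma m (xact a m')) ->
          exists! h : sec H I -> V,
            linear h /\ forall m m', h (beta I m m') = gamma m m'].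

(* F twisted by the character lambda of T. *)
Section Twist.
Variables (lambda : expo) (F : eqsheaf).

Definition twtact (I : opens) (t : {ffun 'I_n.+1 -> C}) (m : sec F I) : sec F I :=
  tpow t lambda *: tact t m.

Fact twtact_linear I t : torus t -> linear (@twtact I t).
Proof.
by move=> tt c x y; rewrite /twtact (tact_linear tt) scalerDr !scalerA mulrC.
Qed.

Fact twtact1 I m : @twtact I [ffun=> 1] m = m.
Proof. by rewrite /twtact tpow1 scale1r tact1. Qed.

Fact twtactM I s t m : torus s -> torus t ->
  @twtact I [ffun i => s i * t i] m = twtact s (twtact t m).
Proof.
by move=> ts tt; rewrite /twtact tactM // (linZ _ _ (tact_linear ts)) scalerA tpowM.
Qed.

Fact twtact_rational I (m : sec F I) : exists s : seq (expo * sec F I),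
  (forall p, p \in s -> forall t, torus t -> twtact t p.2 = tpow t p.1 *: p.2)
  /\ m = \sum_(p <- s) p.2.
Proof.
have [s [hs ->]] := tact_rational m.
exists [seq (lambda + p.1, p.2) | p <- s]; split; last by rewrite big_map.
move=> _ /mapP[p ps ->] t tt /=.
by rewrite /twtact hs // scalerA tpowD.
Qed.

Fact twtact_xact (I : opens) t a m : torus t -> regular I a ->
  @twtact I t (xact a m) = tpow t (- a) *: xact a (twtact t m).
Proof.
move=> tt ra; rewrite /twtact tact_xact // (linZ _ _ (xact_linear ra)).
by rewrite !scalerA mulrC.
Qed.

Fact twres_tact (I J : opens) t m : oset I \subset oset J -> torus t ->
  @res F I J (twtact t m) = twtact t (res J m).
Proof.
by move=> sIJ tt; rewrite /twtact (linZ _ _ (res_linear sIJ)) res_tact.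
Qed.

Definition twist : eqsheaf := @EqSheaf (sec F) (@xact F) twtact (@res F)
  (@xact_linear F) (@xact0 F) (@xactD F)
  twtact_linear twtact1 twtactM twtact_rational twtact_xact
  (@res_linear F) (@res_id F) (@res_comp F) (@res_xact F) twres_tact
  (@res_ker F) (@res_loc F).

End Twist.

Record cohsheaf := CohSheaf { csheaf :> eqsheaf; _ : coherent csheaf }.

Fact OX_coherent u : coherent (OXsheaf u).
Proof.
move=> I; exists 1, (fun=> omon u I 0) => m.
pose h : osec u I -> regfun I := mlift (fun a => omon ord_max I (val a)).
exists (fun=> h m); rewrite big_ord1 /funact.
apply: (@eq_linear_malg C _ (osec u I) (fun m => m)
  (fun m => mlift (fun a : {a : expo | xmon ord_max I a} =>
                     oxact (val a) (omon u I 0)) (h m))) => // [c x y|k].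
  by rewrite /h !mlift_linear.
rewrite /h mliftU; have /andP[rk _] := valP k.
have xk : xmon ord_max I (val k).
  rewrite /xmon rk; apply/forallP => j; apply/implyP.
  by rewrite ltnNge -ltnS ltn_ord.
rewrite (omon_lift (fun a => oxact a (omon u I 0)) xk) oxact_omon ?regular0 //.
by rewrite add0r omonE.
Qed.

Fact twist_coherent lambda (F : cohsheaf) : coherent (twist lambda F).
Proof. by case: F => F cF I; apply: (cF I). Qed.

Definition OX (u : 'I_n.+1) : cohsheaf := CohSheaf (@OX_coherent u).
Definition ctwist (lambda : expo) (F : cohsheaf) : cohsheaf :=
  CohSheaf (@twist_coherent lambda F).

(* K_T(P^n): formal Z-linear combinations of coherent sheaves modulo [Keq], the
   congruence generated by the abelian group laws and [F] = [F'] + [F''] for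
   short exact sequences 0 -> F' -> F -> F'' -> 0. It is kept as a setoid, since
   the free abelian group on [cohsheaf] as a [zmodType] would make the universes
   inconsistent. *)
Definition KT := seq (int * cohsheaf).
Definition Kcl (F : cohsheaf) : KT := [:: (1, F)].

Inductive Keq : KT -> KT -> Prop :=
| Keq_refl x : Keq x x
| Keq_sym x y : Keq x y -> Keq y x
| Keq_trans x y z : Keq x y -> Keq y z -> Keq x z
| Keq_cat x x' y y' : Keq x x' -> Keq y y' -> Keq (x ++ y) (x' ++ y')
| Keq_catC x y : Keq (x ++ y) (y ++ x)
| Keq_zero F : Keq [:: (0, F)] [::]
| Keq_add k l F : Keq [:: (k, F); (l, F)] [:: (k + l, F)]
| Keq_exact k (F' F F'' : cohsheaf) : short_exact F' F F'' ->
    Keq [:: (k, F)] [:: (k, F'); (k, F'')].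

(* e^lambda acts by twisting by lambda; up to isomorphism the twist does not
   depend on the representative of lambda in [expo]. *)
Definition Kscale (c : RT n) (x : KT) : KT :=
  [seq (c@_l * p.1, ctwist (repr l) p.2) | l <- enum_fset (msupp c), p <- x].

Definition Ksum (F : 'I_n.+1 -> KT) : KT := flatten [seq F w | w <- enum 'I_n.+1].

Fixpoint Kbundles (x : KT) : Prop :=
  if x is (_, F) :: y then locally_free F /\ Kbundles y else True.

(* z is the product of x and y in the ring K_T(P^n): the product comes from the
   tensor product of equivariant vector bundles through the isomorphism of the
   Grothendieck group of equivariant vector bundles with K_T(P^n). *)
Definition Kprod (x y z : KT) : Prop :=
  exists (p q : KT) (tens : cohsheaf -> cohsheaf -> cohsheaf),
    [/\ Kbundles p, Kbundles q,
        forall E F : cohsheaf, locally_free E -> locally_free F ->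
          is_tensor E F (tens E F),
        Keq x p /\ Keq y q
      & Keq z [seq (a.1 * c.1, tens a.2 c.2) | a <- p, c <- q]].

(* b u v w is the structure constant b^w_{u,v}. *)
Definition structure_constants
    (b : 'I_n.+1 -> 'I_n.+1 -> 'I_n.+1 -> RT n) : Prop :=
  forall u v, Kprod (Kcl (OX u)) (Kcl (OX v))
                    (Ksum (fun w => Kscale (b u v w) (Kcl (OX w)))).

End ProjectiveSpace.

(* rev_ord u has value n - u. *)
Definition rconst n (b : 'I_n.+1 -> 'I_n.+1 -> 'I_n.+1 -> RT n)
    (u v w : 'I_n.+1) : RT n :=
  wo (b (rev_ord u) (rev_ord v) (rev_ord w)).

Definition rtilde n (b : 'I_n.+1 -> 'I_n.+1 -> 'I_n.+1 -> RT n)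
    (u v w : 'I_n.+1) : RT n :=
  (-1) ^+ (u + v + w)%N * rconst b u v w.

(* Main.v *)
Require Import Defs.
From HB Require Import structures.
From mathcomp Require Import all_boot all_order all_algebra.
From mathcomp Require Import finmap.
From mathcomp.multinomials Require Import monalg.
From mathcomp Require Import boolp reals.
From mathcomp.real_closed Require Import complex.
From mathcomp Require Import ring.

Set Implicit Arguments.
Unset Strict Implicit.
Unset Printing Implicit Defensive.

Import Order.TTheory GRing.Theory Num.Theory.
Local Open Scope quotient_scope.
Local Open Scope ring_scope.

(* Localization at the T-fixed points of P^n. On the chart U_i around the i-th
   fixed point the weight spaces of a coherent equivariant sheaf are
   finite-dimensional, so the sheaf has a formal character, which is additive on
   exact sequences. For a vector bundle E, the trace of the identity on each
   weight space, computed on a dual basis over O(U_i), shows that the character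
   of E is a finite sum P of characters times that of O(U_i), and that the
   character of the tensor product of E and F is P times the character of F. The
   character of O_{X_u} is that of O(U_i) times the product of the
   1 - e^(eps_i - eps_j) for j > u, or 0 if i > u. So the structure constants
   satisfy, for every i, an identity in R(T); these identities form a triangular
   system whose diagonal entries are not zero divisors.

   After w_o and a change of sign the system says that r~^w_{u,v} is, up to
   characters, the coefficient of N_w in the expansion of N_u N_v, where
   N_u(z) = (z - x_1)...(z - x_u) is the Newton basis at the points
   x_i = e^(eps_i). If N' is the Newton basis at x_2, x_3, ... then
   N_u N_v = (z - x_1) ((z - x_{u+1}) + (x_{u+1} - x_1)) N'_{u-1} N'_{v-1}
           = (z - x_1) (N'_u N'_{v-1} + (x_{u+1} - x_1) N'_{u-1} N'_{v-1}),
   and (z - x_1) N'_{w-1} = N_w: this is the recursion. *)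

(** * Weights and characters of the torus *)

Section Weights.
Variable n : nat.
Local Notation expo := {ffun 'I_n.+1 -> int}.

Lemma wtD (a b : expo) : wt (a + b) = wt a + wt b.
Proof. exact: (raddfD \pi_(weight n)). Qed.
Lemma wtN (a : expo) : wt (- a) = - wt a.
Proof. exact: (raddfN \pi_(weight n)). Qed.
Lemma wt0 : wt (0 : expo) = 0.
Proof. exact: (raddf0 \pi_(weight n)). Qed.
Lemma wt_repr (x : weight n) : wt (repr x) = x.
Proof. exact: reprK. Qed.

Lemma wtP (a b : expo) : wt a = wt b <-> exists k, forall i, a i = b i + k.
Proof.
split=> [|[k h]].
  move/eqP; rewrite /wt -Quotient.idealrBE => /forallP h.
  exists ((a - b) ord0) => i; rewrite -(eqP (h i)) !ffunE; ring.
apply/eqP; rewrite /wt -Quotient.idealrBE; apply/forallP => i.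
by rewrite !ffunE !h !(addrC (b _)) !addrK.
Qed.

Lemma repr_wt (a : expo) : exists k, forall i, repr (wt a) i = a i + k.
Proof. by apply/wtP; rewrite wt_repr. Qed.

(* The only candidate exponent of a rational monomial of degree 0 on P^n that
   has weight x. *)
Definition wexp (x : weight n) : expo :=
  [ffun k => (((\sum_l repr x l) %/ n.+1%:Z)%Z - repr x k)].

(** Adding k to every entry of a representative adds k(n+1) to its sum, so the floor quotient moves
    by exactly k and [wexp] ignores the choice of representative. If n+1 does not divide the sum,
    [wexp x] has nonzero degree and is never [regular]. *)
Lemma wexpB (x : weight n) (b : expo) : \sum_i b i = 0 ->
  wexp (x + wt b) = wexp x - b.
Proof.
move=> sb; have [k hk] : exists k, forall i, repr (x + wt b) i = (repr x + b) i + k.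
  by apply/wtP; rewrite wt_repr wtD wt_repr.
apply/ffunP => i; rewrite !ffunE.
have -> : \sum_l repr (x + wt b) l = \sum_l repr x l + k * n.+1%:Z.
  under eq_bigr do rewrite hk ffunE.
  by rewrite !big_split /= sb addr0 sumr_const card_ord -mulr_natr natz.
rewrite (addrC (\sum_l _)) divzMDl // hk !ffunE; ring.
Qed.

Lemma wexp0 : wexp 0 = 0.
Proof.
have [k hk] := repr_wt 0; rewrite wt0 in hk.
have e i : repr (0 : weight n) i = k by rewrite hk ffunE add0r.
apply/ffunP => i; rewrite !ffunE; under eq_bigr do rewrite e.
by rewrite sumr_const card_ord -mulr_natr natz mulzK // e subrr.
Qed.

Lemma wexp_wt (a : expo) : \sum_i a i = 0 -> wexp (- wt a) = a.
Proof.
move=> sa; rewrite -wtN -[wt _]add0r wexpB ?wexp0 ?sub0r ?opprK //.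
by under eq_bigr do rewrite ffunE; rewrite sumrN sa oppr0.
Qed.

Lemma wt_wexp (x : weight n) : wt (wexp x) = - x.
Proof.
rewrite -[in RHS](wt_repr x) -wtN; apply/wtP.
exists ((\sum_l repr x l) %/ n.+1%:Z)%Z => i; rewrite !ffunE; ring.
Qed.

End Weights.

Section Characters.
Variables (C : numFieldType) (n : nat).
Local Notation expo := {ffun 'I_n.+1 -> int}.
Implicit Types (x y : weight n) (t : {ffun 'I_n.+1 -> C}).

Definition wchar t x : C := tpow t (repr x).

(** Two representatives differ by a constant k, which contributes the k-th power of the product of
    the t_i, that is 1. *)
Lemma wchar_wt t (a : expo) : torus t -> wchar t (wt a) = tpow t a.
Proof.
move=> tt; have [k hk] := repr_wt a.
rewrite /wchar; have -> : repr (wt a) = a + [ffun=> k].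
  by apply/ffunP => i; rewrite hk !ffunE.
rewrite tpowD // [X in _ * X](_ : _ = 1) ?mulr1 //.
rewrite /tpow (eq_bigr (fun i => t i ^ k)); last by move=> i _; rewrite ffunE.
have -> : \prod_i t i ^ k = (\prod_i t i) ^ k.
  elim/big_rec2: _ => [|i y1 y2 _ ->]; first by rewrite exp1rz.
  by rewrite expfzMl.
by rewrite (eqP tt) exp1rz.
Qed.

Lemma wcharD t x y : torus t -> wchar t (x + y) = wchar t x * wchar t y.
Proof. by move=> tt; rewrite -(wt_repr x) -(wt_repr y) -wtD !wchar_wt // tpowD. Qed.

Lemma wchar_sep x y : x != y -> exists2 t, torus t & wchar t x != wchar t y.
Proof.
move=> /eqP nxy; apply: contrapT => h; apply: nxy.
rewrite -(wt_repr x) -(wt_repr y); apply/wtP.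
set a := repr x; set b := repr y.
exists (a ord0 - b ord0) => i.
have [->|i0] := eqVneq i ord0; first by ring.
have i0' : (ord0 == i) = false by rewrite eq_sym; apply: negbTE.
(* With entries 2 and 1/2 at i and 0, t sees only the difference of these two exponents, and the
   powers of 2 are distinct in characteristic 0. *)
pose t : {ffun 'I_n.+1 -> C} :=
  [ffun j => if j == i then 2 else if j == ord0 then 2^-1 else 1].
have pt (c : expo) : tpow t c = 2 ^ (c i - c ord0).
  rewrite /tpow (bigD1 i) //= (bigD1 ord0) 1?eq_sym //= big1 ?mulr1.
    rewrite !ffunE !eqxx i0' exprz_inv.
    by rewrite -expfzDr ?pnatr_eq0.
  by move=> j /andP[/negbTE ji /negbTE j0]; rewrite ffunE ji j0 exp1rz.
have tt : torus t.
  rewrite /torus inE /= (bigD1 i) //= (bigD1 ord0) 1?eq_sym //= big1 ?mulr1.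
    by rewrite !ffunE !eqxx i0' divff ?pnatr_eq0.
  by move=> j /andP[/negbTE ji /negbTE j0]; rewrite ffunE ji j0.
have : tpow t a = tpow t b.
  by apply: contrapT => /eqP ne; apply: h; exists t.
have pow2 (k : nat) : ((2 : C) ^+ k == 1) = (k == 0)%N.
  by rewrite -natrX (eqr_nat _ _ 1) -(expn0 2) eqn_exp2l.
have pow2z (k : int) : (2 : C) ^ k = 1 -> k = 0.
  case: k => k /eqP; first by rewrite pow2 => /eqP ->.
  by rewrite NegzE -exprz_inv -exprnP exprVn invr_eq1 pow2.
rewrite !pt => e2.
have e : a i - a ord0 - (b i - b ord0) = 0.
  apply: pow2z; rewrite expfzDr ?pnatr_eq0 // e2 -expfzDr ?pnatr_eq0 //.
  by rewrite subrr.
by apply/eqP; rewrite -subr_eq0; apply/eqP; rewrite -e; ring.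
Qed.

End Characters.

(** * Dimension of subspaces *)

Section Dimension.
Variables (K : fieldType) (V : lmodType K).
Implicit Types (W : V -> Prop).

Definition lincomb d (e : 'I_d -> V) (c : 'rV[K]_d) : V := \sum_k c 0 k *: e k.

(** A relation on predicates: spaces of sections may be infinite-dimensional, and only certain
    subspaces are shown to have a dimension. *)
Definition has_dim W d := exists e : 'I_d -> V,
  [/\ forall k, W (e k), forall c, lincomb e c = 0 -> c = 0
    & forall m, W m -> exists c, m = lincomb e c].

Definition subspace W := W 0 /\ forall a u v, W u -> W v -> W (a *: u + v).

Lemma lincomb_linear d (e : 'I_d -> V) : linear (lincomb e).
Proof.
move=> a c1 c2; rewrite /lincomb scaler_sumr -big_split /=.
by apply: eq_bigr => k _; rewrite !mxE scalerDl scalerA.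
Qed.

Lemma lincomb_mul d1 d2 (e : 'I_d2 -> V) (c : 'rV_d1) (M : 'M_(d1, d2)) :
  lincomb e (c *m M) = lincomb (fun k => lincomb e (row k M)) c.
Proof.
rewrite /lincomb; under [RHS]eq_bigr do rewrite scaler_sumr.
rewrite exchange_big /=; apply: eq_bigr => k _.
rewrite mxE scaler_suml; apply: eq_bigr => j _.
by rewrite !mxE scalerA.
Qed.

Lemma lincomb_sub W d (e : 'I_d -> V) c : subspace W -> (forall k, W (e k)) ->
  W (lincomb e c).
Proof.
move=> [W0 WD] We; rewrite /lincomb; elim/big_rec: _ => // k v _ Wv.
exact: WD.
Qed.

Lemma lincomb_delta d (e : 'I_d -> V) k : lincomb e (delta_mx 0 k) = e k.
Proof.
rewrite /lincomb (bigD1 k) //= mxE !eqxx scale1r big1 ?addr0 // => j /negbTE jk.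
by rewrite mxE jk andbF scale0r.
Qed.

Lemma lincomb_matrix d1 d2 (e : 'I_d2 -> V) (f : 'I_d1 -> V) :
  (forall k, exists c, f k = lincomb e c) ->
  exists M, forall k, f k = lincomb e (row k M).
Proof.
move=> /choice[c fc]; exists (\matrix_(k, j) c k 0 j) => k.
by rewrite fc; congr lincomb; apply/rowP => j; rewrite !mxE.
Qed.

(** The matrices M and N expressing each basis in the other satisfy M N = 1, so d1 is at most the
    rank of M. *)
Lemma has_dim_le W d1 d2 : has_dim W d1 -> has_dim W d2 -> (d1 <= d2)%N.
Proof.
move=> [e [We fe se]] [f [Wf ff sf]].
have [M eM] := lincomb_matrix (fun k => sf _ (We k)).
have [N fN] := lincomb_matrix (fun k => se _ (Wf k)).
have MN : M *m N = 1%:M.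
  apply/row_matrixP => k; rewrite rowE mulmxA -rowE row1.
  have := fe (row k M *m N - delta_mx 0 k).
  rewrite -scaleN1r addrC lincomb_linear lincomb_mul lincomb_delta !scaleN1r.
  have -> : lincomb (fun j => lincomb e (row j N)) (row k M) = e k.
    by rewrite (eM k); apply: eq_bigr => j _ /=; rewrite -fN.
  by move=> /(_ (addNr _)) /eqP; rewrite addrC subr_eq0 => /eqP.
rewrite -(mxrank1 K d1) -MN; apply: leq_trans (mxrankM_maxl _ _) _.
exact: rank_leq_col.
Qed.

Lemma has_dim_inj W d1 d2 : has_dim W d1 -> has_dim W d2 -> d1 = d2.
Proof. by move=> h1 h2; apply/eqP; rewrite eqn_leq !(@has_dim_le W). Qed.

Lemma has_dim_ext W W' d : (forall m, W m <-> W' m) -> has_dim W d -> has_dim W' d.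
Proof.
move=> WW' [e [We fe se]]; exists e; split=> // [k|m /WW'/se //].
exact/WW'.
Qed.

(** Induction on the number of generators: a nontrivial relation expresses one of them through the
    others, and it is dropped. *)
Lemma has_dim_finite W N (z : 'I_N -> V) : subspace W -> (forall k, W (z k)) ->
  (forall m, W m -> exists c, m = lincomb z c) -> exists d, has_dim W d.
Proof.
move=> sW; elim: N z => [|N IH] z Wz sz.
  by exists 0, z; split=> // c _; apply/rowP => -[].
have [fz|/existsNP[c /not_implyP[c0 /eqP cn]]] :=
  pselect (forall c, lincomb z c = 0 -> c = 0); first by exists N.+1, z.
have /rV0Pn[k ck] := cn.
apply: (IH (fun j => z (lift k j))) => [j|m /sz[b ->]]; first exact: Wz.
have zk : z k = lincomb (fun j => z (lift k j))
    (- (c 0 k)^-1 *: (\row_j c 0 (lift k j))).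
  move: c0; rewrite /lincomb (bigD1_ord k) //= => /eqP.
  rewrite addr_eq0 => /eqP h.
  rewrite -[LHS]scale1r -(mulVf ck) -scalerA h scalerN scaler_sumr -sumrN.
  by apply: eq_bigr => j _; rewrite !mxE scalerA mulNr scaleNr.
exists (b 0 k *: (- (c 0 k)^-1 *: (\row_j c 0 (lift k j))) + \row_j b 0 (lift k j)).
rewrite lincomb_linear -zk {1}/lincomb (bigD1_ord k) //=; congr (_ + _).
by apply: eq_bigr => j _; rewrite mxE.
Qed.

(** In a rank factorization A = X Y, idempotence reads X (Y X) Y = X Y; cancelling X and Y gives Y X
    = 1, whose trace is the rank. *)
Lemma trace_idem N (A : 'M[K]_N) : A *m A = A -> \tr A = (\rank A)%:R.
Proof.
move=> AA; have e := mulmx_base A.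
have h : row_base A *m col_base A = 1%:M.
  have fX := row_full_inj (col_base_full A); have fY := row_free_inj (row_base_free A).
  move: (col_base A) (row_base A) e fX fY => X Y e fX fY.
  by apply/fX/fY; rewrite /= mulmx1 mulmxA -mulmxA e AA.
by rewrite -{1}e mxtrace_mulC h mxtrace1.
Qed.

(* The dimension of W is the trace of its identity map, computed on a dual
   basis which need not be free. *)
Lemma has_dim_trace W N (z : 'I_N -> V) (xi : 'I_N -> V -> K) :
  subspace W -> (forall k, W (z k)) ->
  (forall k a u v, xi k (a *: u + v) = a * xi k u + xi k v) ->
  (forall m, W m -> m = \sum_k xi k m *: z k) ->
  exists2 d, has_dim W d & d%:R = \sum_k xi k (z k).
Proof.
move=> sW Wz lxi sz.
pose g m : 'rV_N := \row_k xi k m.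
have xi0 k : xi k 0 = 0.
  by apply: (addIr (xi k 0)); rewrite -{1}[xi k 0]mul1r -lxi scale1r !add0r.
have lg : linear g by move=> a u v; apply/rowP => k; rewrite !mxE lxi.
have g0 : g 0 = 0 by apply/rowP => k; rewrite !mxE xi0.
have fg m : W m -> lincomb z (g m) = m.
  by move=> /sz e; rewrite [RHS]e; apply: eq_bigr => k _; rewrite mxE.
(* [A] sends coordinates to the dual coordinates of the vector they represent. It is idempotent
   since the [z k] lie in W, and its row space is a copy of W. *)
pose A : 'M_N := \matrix_(j, k) xi k (z j).
have gf c : g (lincomb z c) = c *m A.
  have gs (r : seq 'I_N) : 
      g (\sum_(k <- r) c 0 k *: z k) = \sum_(k <- r) c 0 k *: g (z k).
    by elim: r => [|k r IH]; rewrite ?big_nil // !big_cons lg IH.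
  rewrite /lincomb gs; apply/rowP => k; rewrite mxE summxE.
  by apply: eq_bigr => j _; rewrite !mxE.
have AA : A *m A = A.
  apply/row_matrixP => k; rewrite rowE mulmxA -rowE -gf.
  have -> : row k A = g (z k) by apply/rowP => j; rewrite !mxE.
  by rewrite fg.
have bA : row_base A *m A = row_base A.
  have /submxP[D ->] : (row_base A <= A)%MS by rewrite eq_row_base.
  by rewrite -mulmxA AA.
exists (\rank A); last first.
  by rewrite -trace_idem //; apply: eq_bigr => k _; rewrite mxE.
exists (fun k => lincomb z (row k (row_base A))); split.
- by move=> k; apply: lincomb_sub.
- move=> c; rewrite -lincomb_mul => /(congr1 g); rewrite g0 gf -mulmxA bA.
  by move=> h; apply: (row_free_inj (row_base_free A)); rewrite mul0mx.
move=> m Wm; have : (g m <= row_base A)%MS.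
  by rewrite eq_row_base -{1}(fg m Wm) gf submxMl.
by move=> /submxP[D e]; exists D; rewrite -lincomb_mul -e fg.
Qed.

End Dimension.

Lemma lincomb_image (K : fieldType) (V V' : lmodType K) (f : V -> V') d
    (e : 'I_d -> V) c :
  linear f -> f (lincomb e c) = lincomb (f \o e) c.
Proof.
move=> lf; rewrite /lincomb; elim: (index_enum _) => [|k r IH].
  by rewrite !big_nil lin0.
by rewrite !big_cons lf IH.
Qed.

(** The images of a basis of W1 together with lifts of a basis of W3 form a basis of W2. *)
Lemma has_dim_exact (K : fieldType) (V1 V2 V3 : lmodType K)
    (W1 : V1 -> Prop) (W2 : V2 -> Prop) (W3 : V3 -> Prop)
    (f : V1 -> V2) (g : V2 -> V3) d1 d3 :
  linear f -> linear g -> injective f -> subspace W2 ->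
  (forall m, W1 m -> W2 (f m)) -> (forall m, W2 m -> W3 (g m)) ->
  (forall m, W1 m -> g (f m) = 0) ->
  (forall m, W2 m -> g m = 0 -> exists2 m', W1 m' & f m' = m) ->
  (forall m, W3 m -> exists2 m', W2 m' & g m' = m) ->
  has_dim W1 d1 -> has_dim W3 d3 -> has_dim W2 (d1 + d3).
Proof.
move=> lf lg injf sW f12 g23 gf0 ker2 sur3 [e1 [We1 fe1 se1]] [e3 [We3 fe3 se3]].
have /choice[e2 he2] : forall k, exists m, W2 m /\ g m = e3 k.
  by move=> k; have [m Wm gm] := sur3 _ (We3 k); exists m.
pose e k := match split k with inl j => f (e1 j) | inr j => e2 j end.
have lcE c : lincomb e c = f (lincomb e1 (lsubmx c)) + lincomb e2 (rsubmx c).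
  rewrite (lincomb_image _ _ lf) {1}/lincomb big_split_ord /=; congr (_ + _).
    by apply: eq_bigr => j _; rewrite /e (unsplitK (inl j)) !mxE.
  by apply: eq_bigr => j _; rewrite /e (unsplitK (inr j)) !mxE.
have ge2 c : g (lincomb e2 c) = lincomb e3 c.
  by rewrite (lincomb_image _ _ lg); apply: eq_bigr => k _ /=; rewrite (he2 k).2.
have gD u v : g (u + v) = g u + g v by have := lg 1 u v; rewrite !scale1r.
have sub1 c : W2 (f (lincomb e1 c)).
  by rewrite (lincomb_image _ _ lf); apply: lincomb_sub => // k; apply: f12.
have gf c : g (f (lincomb e1 c)) = 0.
  rewrite (lincomb_image _ _ lf) (lincomb_image _ _ lg) /lincomb big1 // => k _.
  by rewrite /= gf0 ?scaler0.
exists e; split.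
- by move=> k; rewrite /e; case: split => j; [apply: f12|case: (he2 j)].
- move=> c; rewrite lcE => h.
  have c3 : rsubmx c = 0.
    by apply: fe3; move/(congr1 g): h; rewrite gD gf add0r ge2 (lin0 lg).
  have c1 : lsubmx c = 0.
    apply: fe1; apply: injf; rewrite (lin0 lf) -h c3.
    by rewrite /lincomb [X in _ + X]big1 ?addr0 // => k _; rewrite mxE scale0r.
  by rewrite -(hsubmxK c) c1 c3 row_mx0.
move=> m Wm; have [c3 hc3] := se3 _ (g23 _ Wm).
have [||m1 Wm1 hm1] := ker2 (m - lincomb e2 c3).
- rewrite addrC -scaleN1r; apply: sW.2 => //.
  by apply: lincomb_sub => // k; case: (he2 k).
- by rewrite addrC -scaleN1r lg ge2 scaleN1r hc3 addNr.
have [c1 hc1] := se1 _ Wm1.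
exists (row_mx c1 c3); rewrite lcE row_mxKl row_mxKr -hc1 hm1.
by rewrite subrK.
Qed.

(** * Weight spaces of equivariant sheaves *)

Lemma lin_sum (K : fieldType) (V W : lmodType K) (f : V -> W) (T : Type)
    (r : seq T) (P : pred T) (v : T -> V) :
  linear f -> f (\sum_(j <- r | P j) v j) = \sum_(j <- r | P j) f (v j).
Proof.
move=> lf; elim: r => [|j r IH]; first by rewrite !big_nil lin0.
rewrite !big_cons; case: (P j) => //.
by have := lf 1 (v j) (\sum_(j <- r | P j) v j); rewrite !scale1r IH.
Qed.

Lemma sum_cond1 (V : nmodType) (T : eqType) (s : seq T) (k0 : T) (F : T -> V) :
  uniq s -> (k0 \notin s -> F k0 = 0) -> \sum_(k <- s | k == k0) F k = F k0.
Proof.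
move=> us h; rewrite big_mkcond /=; case: (boolP (k0 \in s)) => ks.
  by rewrite (bigD1_seq k0) //= eqxx big1 ?addr0 // => k /negbTE ->.
rewrite h // big_seq big1 // => k k_s.
by case: eqP => // kk; rewrite kk in k_s; rewrite k_s in ks.
Qed.

Section WeightSpaces.
Variables (C : numFieldType) (n : nat).
Local Notation expo := {ffun 'I_n.+1 -> int}.

Section Sheaf.
Variables (F : eqsheaf C n) (I : opens n).
Implicit Types (x y : weight n) (m : sec F I).

Definition wspace x m := forall t, torus t -> tact t m = wchar t x *: m.

Lemma wspace_subspace x : subspace (wspace x).
Proof.
split=> [t tt|a u v hu hv t tt].
  by rewrite (lin0 (tact_linear tt)) scaler0.
by rewrite (tact_linear tt) hu // hv // scalerDr !scalerA mulrC.
Qed.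

Lemma wspaceZ x a m : wspace x m -> wspace x (a *: m).
Proof.
move=> h; rewrite -[_ *: m]addr0; have [h0 hD] := wspace_subspace x.
exact: hD.
Qed.

Lemma wspace_sum x T (r : seq T) (P : pred T) (v : T -> sec F I) :
  (forall j, P j -> wspace x (v j)) -> wspace x (\sum_(j <- r | P j) v j).
Proof.
move=> h; have [h0 hD] := wspace_subspace x.
by elim/big_ind: _ => // u v' hu hv; rewrite -[u]scale1r; apply: hD.
Qed.

Lemma wspace_xact x a m : regular I a -> wspace x m ->
  wspace (x - wt a) (xact a m).
Proof.
move=> ra h t tt; rewrite tact_xact // h // (linZ _ _ (xact_linear ra)) scalerA.
by rewrite wcharD // -wtN wchar_wt // mulrC.
Qed.

Lemma wspace_indep x m (s : seq (weight n * sec F I)) : wspace x m ->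
  (forall p, p \in s -> wspace p.1 p.2 /\ p.1 != x) ->
  m + \sum_(p <- s) p.2 = 0 -> m = 0.
Proof.
have [k] := ubnP (size s); elim: k s m => // k IH [|p s] m /= sk hm hs.
  by rewrite big_nil addr0.
have [hp px] := hs p (mem_head _ _).
have [t tt tpx] := wchar_sep C px.
(* As t separates [p.1] from x, [f] kills the first vector of the list and multiplies m by a nonzero
   scalar. *)
pose f (v : sec F I) := tact t v + (- wchar t p.1) *: v.
have lf : linear f.
  move=> a u v; rewrite /f (tact_linear tt) !scalerDr !scalerA.
  by rewrite addrACA (mulrC a).
have fE y v : wspace y v -> f v = (wchar t y - wchar t p.1) *: v.
  by move=> hv; rewrite /f hv // -scalerDl.
rewrite big_cons => /(congr1 f); rewrite (lin0 lf) addrCA.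
have fD u v : f (u + v) = f u + f v by have := lf 1 u v; rewrite !scale1r.
rewrite fD (fE _ _ hp) subrr scale0r add0r fD (fE _ _ hm) (lin_sum _ _ _ lf) => h.
have := IH [seq (q.1, f q.2) | q <- s] ((wchar t x - wchar t p.1) *: m).
rewrite size_map big_map => /(_ sk (wspaceZ _ hm)) h2.
have /eqP : (wchar t x - wchar t p.1) *: m = 0.
  apply: h2 => // _ /mapP[q qs ->] /=.
  have [hq qx] := hs q (mem_behead (s := p :: s) qs); split=> //.
  by rewrite (fE _ _ hq); apply: wspaceZ.
by rewrite scaler_eq0 subr_eq0 eq_sym (negbTE tpx) => /eqP.
Qed.

(** The difference of the two sides has weight x and is a sum of vectors of other weights, hence it
    is 0. *)
Lemma wspace_proj x m (T : eqType) (s : seq T) (y : T -> weight n) (v : T -> sec F I) :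
  wspace x m -> (forall j, wspace (y j) (v j)) -> m = \sum_(j <- s) v j ->
  m = \sum_(j <- s | y j == x) v j.
Proof.
move=> hm hv e; apply/eqP; rewrite -subr_eq0; apply/eqP.
pose s' := [seq (y j, - v j) | j <- s & y j != x].
apply: (@wspace_indep x _ s').
- rewrite addrC -scaleN1r; apply: (wspace_subspace x).2 => //.
  by apply: wspace_sum => j /eqP <-.
- move=> _ /mapP[j + ->] /=; rewrite mem_filter => /andP[yj _]; split=> //.
  by rewrite -scaleN1r; apply: wspaceZ.
rewrite /s' big_map big_filter {1}e (bigID (fun j => y j == x)) /=.
by rewrite sumrN (addrC (bigop.body _ _ _)) addrK subrr.
Qed.

Lemma weight_decomp m : exists2 s : seq (weight n * sec F I),
  forall p, p \in s -> wspace p.1 p.2 & m = \sum_(p <- s) p.2.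
Proof.
have [s [hs ->]] := tact_rational m.
exists [seq (wt p.1, p.2) | p <- s]; last by rewrite big_map.
by move=> _ /mapP[p ps ->] t tt /=; rewrite wchar_wt // hs.
Qed.

End Sheaf.

(* The affine neighbourhood x_i <> 0 of the i-th fixed point of T. *)
Fact fixpt_subproof (i : 'I_n.+1) : [set i] != set0.
Proof. by apply/set0Pn; exists i; rewrite inE. Qed.
Definition chart (i : 'I_n.+1) : opens n := Opens (fixpt_subproof i).

End WeightSpaces.

(** * Homogeneous generators and finiteness of the weight spaces *)

Section Generators.
Variables (C : numFieldType) (n : nat).
Local Notation expo := {ffun 'I_n.+1 -> int}.

Lemma xmon_max (I : {set 'I_n.+1}) (a : expo) : xmon ord_max I a = regular I a.
Proof.
rewrite /xmon; case: regular => //=; apply/forallP => j.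
by rewrite ltnNge -ltnS ltn_ord.
Qed.

Variable (I : opens n).
Local Notation regs := {a : expo | xmon ord_max I a}.

Definition mon_coef (a : expo) (f : regfun C I) : C :=
  if insub a is Some s then (f : {malg C[regs]})@_s else 0.

Lemma mon_coef_linear a c (f g : regfun C I) :
  mon_coef a (c *: f + g) = c * mon_coef a f + mon_coef a g.
Proof.
rewrite /mon_coef; case: insubP => [s _ _|_]; last by rewrite mulr0 addr0.
by rewrite mcoeffD mcoeffZ.
Qed.

Section OneSheaf.
Variable (F : eqsheaf C n).

Lemma funactE (f : regfun C I) (m : sec F I) :
  funact f m = \sum_(k <- msupp (f : {malg C[regs]}))
    (f : {malg C[regs]})@_k *: xact (val k) m.
Proof. by []. Qed.

Lemma regs_regular (k : regs) : regular I (val k).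
Proof. by rewrite -xmon_max (valP k). Qed.

Lemma funact_sum (f : regfun C I) (T : Type) (r : seq T) (v : T -> sec F I) :
  funact f (\sum_(j <- r) v j) = \sum_(j <- r) funact f (v j).
Proof.
under [RHS]eq_bigr do rewrite funactE.
rewrite funactE exchange_big /=; apply: eq_bigr => k _.
by rewrite (lin_sum _ _ _ (xact_linear (regs_regular k))) scaler_sumr.
Qed.

Lemma funact_linear (m : sec F I) : linear (fun f : regfun C I => funact f m).
Proof. exact: mlift_linear. Qed.

(* The multiple of y by a monomial that has weight x when y has weight mu, or 0
   if there is none. *)
Definition shift_to (x mu : weight n) (y : sec F I) : sec F I :=
  if regular I (wexp (x - mu)) then xact (wexp (x - mu)) y else 0.

Lemma wspace_shift_to x mu y : wspace mu y -> wspace x (shift_to x mu y).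
Proof.
rewrite /shift_to; case: ifP => [ra hy|_ _]; last exact: (wspace_subspace F I x).1.
by have := wspace_xact ra hy; rewrite wt_wexp opprK addrC subrK.
Qed.

(** The monomial x^a moves weight mu to mu - [wt a], and [wexp] recovers a from its weight, so at
    most one monomial of f lands in weight x. *)
Lemma funact_component x mu y (f : regfun C I) :
  \sum_(k <- msupp (f : {malg C[regs]}) | mu - wt (val k) == x)
    (f : {malg C[regs]})@_k *: xact (val k) y
  = mon_coef (wexp (x - mu)) f *: shift_to x mu y.
Proof.
have cE (k : regs) : (mu - wt (val k) == x) = (val k == wexp (x - mu)).
  apply/eqP/eqP => [<-|->].
    rewrite addrAC subrr add0r wexp_wt //.
    by have /andP[/eqP] := regs_regular k.
  by rewrite wt_wexp opprK addrC subrK.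
rewrite /mon_coef /shift_to; case: insubP => [s|]; rewrite xmon_max => ra.
  rewrite ra => sE; rewrite -sE.
  under eq_bigl do rewrite cE -sE (inj_eq val_inj).
  by rewrite sum_cond1 // => /mcoeff_outdom ->; rewrite scale0r.
rewrite (negbTE ra) scaler0 big1 // => k.
by rewrite cE => /eqP e; have := regs_regular k; rewrite e (negbTE ra).
Qed.

Lemma wspace_component N (y : 'I_N -> sec F I) (mu : 'I_N -> weight n)
    (f : 'I_N -> regfun C I) x m :
  (forall j, wspace (mu j) (y j)) -> wspace x m -> m = \sum_j funact (f j) (y j) ->
  m = \sum_j mon_coef (wexp (x - mu j)) (f j) *: shift_to x (mu j) (y j).
Proof.
move=> hy hm e.
pose s := [seq (j, k) | j <- index_enum 'I_N, k <- msupp (f j : {malg C[regs]})].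
have := @wspace_proj C n F I x m _ s (fun p => mu p.1 - wt (val p.2))
  (fun p => (f p.1 : {malg C[regs]})@_p.2 *: xact (val p.2) (y p.1)) hm.
rewrite big_allpairs_dep /= => -> //.
- rewrite big_mkcond big_allpairs_dep; apply: eq_bigr => j _ /=.
  by rewrite -big_mkcond funact_component.
- by case=> j k; apply: wspaceZ; apply: wspace_xact => //; apply: regs_regular.
Qed.

(** Each [g k] is cut into weight vectors. [idx] remembers where a piece comes from, so the same
    coefficient functions serve and a dual basis remains one. *)
Lemma homogeneous_generators r (g : 'I_r -> sec F I) :
  exists N (idx : 'I_N -> 'I_r) (y : 'I_N -> sec F I) (mu : 'I_N -> weight n),
  (forall j, wspace (mu j) (y j)) /\
  forall f : 'I_r -> regfun C I,
    \sum_k funact (f k) (g k) = \sum_j funact (f (idx j)) (y j).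
Proof.
have /choice[s hs] : forall k, exists s : seq (weight n * sec F I),
    (forall p, p \in s -> wspace p.1 p.2) /\ g k = \sum_(p <- s) p.2.
  by move=> k; have [s h1 h2] := weight_decomp (g k); exists s.
pose L := [seq (k, p) | k <- index_enum 'I_r, p <- s k].
exists (size L), (fun j => (tnth (in_tuple L) j).1),
  (fun j => (tnth (in_tuple L) j).2.2), (fun j => (tnth (in_tuple L) j).2.1).
split=> [j|f].
  have := mem_tnth j (in_tuple L) => /allpairsPdep[k [p [_ ps ->]]] /=.
  exact: (hs k).1.
rewrite -(big_tnth _ _ L xpredT (fun q => funact (f q.1) q.2.2)).
rewrite /L big_allpairs_dep; apply: eq_bigr => k _ /=.
by rewrite (hs k).2 funact_sum.
Qed.

End OneSheaf.
End Generators.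

Section WeightDimension.
Variables (C : numFieldType) (n : nat).

(** Each homogeneous generator has at most one monomial multiple of weight x, and these finitely
    many vectors span. *)
Lemma coherent_has_dim (F : eqsheaf C n) I x : coherent F ->
  exists d, has_dim (@wspace C n F I x) d.
Proof.
move=> /(_ I)[r [g hg]].
have [N [idx [y [mu [hy hf]]]]] := homogeneous_generators g.
apply: (@has_dim_finite _ _ _ N (fun j => shift_to x (mu j) (y j))).
- exact: wspace_subspace.
- by move=> j; apply: wspace_shift_to.
move=> m hm; have [f e] := hg m; rewrite hf in e.
exists (\row_j mon_coef (wexp (x - mu j)) (f (idx j))).
by rewrite [LHS](wspace_component hy hm e); apply: eq_bigr => j _; rewrite mxE.
Qed.

Lemma cohsheafP (F : cohsheaf C n) : coherent F. Proof. by case: F. Qed.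

Definition wdim (F : cohsheaf C n) I x : nat :=
  sval (cid (coherent_has_dim I x (cohsheafP F))).

Lemma wdimP (F : cohsheaf C n) I x : has_dim (@wspace C n F I x) (wdim F I x).
Proof. exact: svalP. Qed.

Lemma wdimE (F : cohsheaf C n) I x d : has_dim (@wspace C n F I x) d -> wdim F I x = d.
Proof. exact: has_dim_inj (wdimP F I x). Qed.

Lemma wdim_exact (F' F F'' : cohsheaf C n) I x : short_exact F' F F'' ->
  wdim F I x = (wdim F' I x + wdim F'' I x)%N.
Proof.
move=> [f [g /(_ I)[injf kerg surg]]]; apply: wdimE.
have lf := @mor_linear _ _ _ _ f I; have lg := @mor_linear _ _ _ _ g I.
apply: (has_dim_exact lf lg injf (wspace_subspace F I x)
  (W1 := @wspace C n F' I x) (W3 := @wspace C n F'' I x)) (wdimP _ _ _) (wdimP _ _ _).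
- by move=> m hm t tt; rewrite -mor_tact // hm // (linZ _ _ lf).
- by move=> m hm t tt; rewrite -mor_tact // hm // (linZ _ _ lg).
- by move=> m _; apply/kerg; exists m.
- move=> m hm /kerg[m' e]; exists m' => // t tt; apply: injf.
  by rewrite mor_tact // e hm // (linZ _ _ lf) e.
move=> m hm; have [m' e] := surg m.
(* The preimage need not be homogeneous, but its component of weight x still maps to m. *)
have [s hs sE] := weight_decomp m'.
exists (\sum_(p <- s | p.1 == x) p.2).
  rewrite big_seq_cond; apply: wspace_sum => p /andP[ps /eqP <-]; exact: hs.
rewrite (lin_sum _ _ _ lg); apply/esym.
pose v p := if p \in s then mor g p.2 else 0.
rewrite big_seq_cond (eq_bigr v) -?big_seq_cond; last first.
  by move=> p /andP[ps _]; rewrite /v ps.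
apply: (@wspace_proj C n F'' I x m _ s (fun p => p.1) v) => //.
- move=> p; rewrite /v; case: ifP => [ps|_]; last exact: (wspace_subspace F'' I _).1.
  by move=> t tt; rewrite -mor_tact // (hs _ ps) // (linZ _ _ lg).
rewrite -e sE (lin_sum _ _ _ lg) big_seq [RHS]big_seq; apply: eq_bigr => p ps.
by rewrite /v ps.
Qed.

Lemma wdim_twist (F : cohsheaf C n) I (l : weight n) x :
  wdim (ctwist (repr l) F) I x = wdim F I (x - l).
Proof.
apply: wdimE; apply: has_dim_ext (wdimP F I (x - l)) => m.
split=> h t tt; last first.
  have := h t tt; rewrite /= /twtact => /(congr1 (fun v => wchar t (- l) *: v)).
  rewrite -/(wchar t l) !scalerA -!wcharD // addNr addrC.
  by rewrite /wchar -{1}(wt0 n) -/(wchar t (wt 0)) wchar_wt // tpow0 scale1r.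
by rewrite /= /twtact (h t tt) scalerA -/(wchar t l) -wcharD // addrC subrK.
Qed.

End WeightDimension.

(** * Functions on U_I and their action on sections *)

Section Functions.
Variables (C : numFieldType) (n : nat) (I : opens n).
Local Notation expo := {ffun 'I_n.+1 -> int}.
Local Notation regs := {a : expo | xmon ord_max I a}.
Implicit Types (f h : regfun C I).

Lemma mon_coef_omon (a b : expo) : regular I b ->
  mon_coef a (omon C ord_max I b : regfun C I) = (a == b)%:R.
Proof.
move=> rb; rewrite /mon_coef /omon; case: insubP => [s _ sa|]; last first.
  by rewrite xmon_max => na; case: eqP => // e; rewrite e rb in na.
by rewrite insubT ?xmon_max // => xb; rewrite mcoeffU -sa eq_sym -val_eqE.
Qed.

Lemma mon_coef_xact (a b : expo) (h : regfun C I) : regular I b ->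
  mon_coef (a + b) (xact b h) = mon_coef a h.
Proof.
move=> rb.
have l1 : linear (fun h : regfun C I => mon_coef (a + b) (xact b h) : C^o).
  by move=> c f g; rewrite (xact_linear rb) mon_coef_linear.
have l2 : linear (fun h : regfun C I => mon_coef a h : C^o).
  by move=> c f g; rewrite mon_coef_linear.
apply: (eq_linear_malg l1 l2) => k.
have rk : regular I (val k) by rewrite -xmon_max (valP k).
have e := oxact_omon C ord_max rk rb.
rewrite omonE; rewrite /= in e *; rewrite e.
by rewrite !mon_coef_omon ?regularD // (inj_eq (addIr b)).
Qed.

Section Action.
Variable (F : eqsheaf C n).
Implicit Types (m : sec F I).

Lemma funact_linearr f : linear (fun m : sec F I => funact f m).
Proof.
move=> c m1 m2; rewrite !funactE scaler_sumr -big_split /=.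
apply: eq_bigr => k _; have rk := regs_regular k.
by rewrite (xact_linear rk) scalerDr !scalerA mulrC.
Qed.

Lemma funact_xactl f m a : regular I a -> funact (xact a f) m = xact a (funact f m).
Proof.
move=> ra.
have l1 : linear (fun f : regfun C I => funact (xact a f) m).
  by move=> c f1 f2; rewrite (xact_linear ra) funact_linear.
have l2 : linear (fun f : regfun C I => xact a (funact f m)).
  by move=> c f1 f2; rewrite funact_linear (xact_linear ra).
apply: (eq_linear_malg l1 l2) => k.
have rk := regs_regular k.
have fo b : regular I b -> funact (omon C ord_max I b : regfun C I) m = xact b m.
  by move=> rb; rewrite /funact (omon_lift (fun a => xact a m)) ?xmon_max.
have e := oxact_omon C ord_max rk ra.
rewrite omonE; rewrite /= in e *; rewrite e.
by rewrite !fo ?regularD // addrC xactD.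
Qed.

Lemma funact_xactr f m a : regular I a -> funact f (xact a m) = xact a (funact f m).
Proof.
move=> ra; rewrite !funactE (lin_sum _ _ _ (xact_linear ra)).
apply: eq_bigr => k _; have rk := regs_regular k.
by rewrite (linZ _ _ (xact_linear ra)) -!xactD // addrC.
Qed.

End Action.

Lemma funactA (F : eqsheaf C n) f h (m : sec F I) :
  funact (funact f h) m = funact f (funact h m).
Proof.
rewrite (funactE f) (funactE f (funact h m)).
rewrite (lin_sum _ _ _ (funact_linear m)); apply: eq_bigr => k _.
rewrite (linZ _ _ (funact_linear m)) funact_xactl //; exact: regs_regular.
Qed.

End Functions.

(** * Characters of vector bundles and tensor products through traces *)

Section Trace.
Variables (C : numFieldType) (n : nat).
Local Notation expo := {ffun 'I_n.+1 -> int}.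

(** This is [has_dim_trace] for the multiples [shift_to x (mu j) (y j)] and the matching
    coefficients of the dual functions: the diagonal entry is [c j] if the monomial is regular, and
    0 otherwise. *)
Lemma wdim_dual (F : cohsheaf C n) (I : opens n) (T : finType)
    (y : T -> sec F I) (mu : T -> weight n) (xi : T -> sec F I -> regfun C I)
    (c : T -> C) x :
  (forall j, wspace (mu j) (y j)) -> (forall j, linear (xi j)) ->
  (forall m, m = \sum_j funact (xi j m) (y j)) ->
  (forall j a, regular I a -> mon_coef a (xi j (xact a (y j))) = c j) ->
  (wdim F I x)%:R = \sum_j c j * (regular I (wexp (x - mu j)))%:R.
Proof.
move=> hy lxi hm hc.
pose z (k : 'I_#|T|) := shift_to x (mu (enum_val k)) (y (enum_val k)) : sec F I.
pose xi' (k : 'I_#|T|) m := mon_coef (wexp (x - mu (enum_val k))) (xi (enum_val k) m).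
have [||||d hd hE] := @has_dim_trace _ _ (@wspace C n F I x) _ z xi'.
- exact: wspace_subspace.
- by move=> k; apply: wspace_shift_to.
- by move=> k a u v; rewrite /xi' lxi mon_coef_linear.
- move=> m Wm; have e := hm m; rewrite big_enum_val in e.
  exact: (wspace_component (fun k => hy (enum_val k)) Wm e).
rewrite (wdimE hd) hE.
rewrite [RHS]big_enum_val; apply: eq_bigr => k _; rewrite /xi' /z /shift_to.
case: ifP => ra; first by rewrite hc // mulr1.
by rewrite (lin0 (lxi _)) mulr0 /mon_coef; case: insubP => // s _ _; rewrite mcoeff0.
Qed.

End Trace.

Section Bundles.
Variables (C : numFieldType) (n : nat) (i : 'I_n.+1).
Local Notation expo := {ffun 'I_n.+1 -> int}.
Local Notation I := (chart i).
Local Notation regs := {a : expo | xmon ord_max I a}.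

(** O(U_i) is a polynomial ring in the x_j / x_i, whose only invertible monomial is 1. *)
Lemma regular_chart_unit (a b : expo) : regular I a -> regular I b ->
  a + b = 0 -> a = 0.
Proof.
move=> /andP[/eqP sa /forallP pa] /andP[_ /forallP pb] ab.
have aj j : j != i -> a j = 0.
  move=> ji; have := pa j; have := pb j; rewrite /= !inE ji !implyTb => b0 a0.
  move/ffunP/(_ j): ab; rewrite !ffunE => /eqP.
  by rewrite paddr_eq0 // => /andP[/eqP].
apply/ffunP => j; rewrite ffunE; have [->|] := eqVneq j i; last exact: aj.
by rewrite (bigD1 i) //= big1 ?addr0 in sa.
Qed.

(** The constant term is evaluation at the i-th fixed point, a ring homomorphism. *)
Lemma mon_coef0M (f h : regfun C I) :
  mon_coef 0 (funact f h) = mon_coef 0 f * mon_coef 0 h.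
Proof.
have l1 : linear (fun f : regfun C I => mon_coef 0 (funact f h) : C^o).
  by move=> c f1 f2; rewrite funact_linear mon_coef_linear.
have l2 : linear (fun f : regfun C I => mon_coef 0 f * mon_coef 0 h : C^o).
  by move=> c f1 f2; rewrite mon_coef_linear mulrDl -mulrA.
apply: (eq_linear_malg l1 l2) => k; have rk := regs_regular k.
rewrite omonE /funact (omon_lift (fun a => xact a h)) ?xmon_max // mon_coef_omon //.
have l3 : linear (fun h : regfun C I => mon_coef 0 (xact (val k) h) : C^o).
  by move=> c f1 f2; rewrite (xact_linear rk) mon_coef_linear.
have l4 : linear (fun h : regfun C I => (0 == val k)%:R * mon_coef 0 h : C^o).
  by move=> c f1 f2; rewrite mon_coef_linear mulrDr mulrCA.
apply: (eq_linear_malg l3 l4) => l; have rl := regs_regular l.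
have e := oxact_omon C ord_max rl rk.
rewrite omonE; rewrite /= in e *; rewrite e.
rewrite !mon_coef_omon ?regularD // -natrM mulnb; congr (nat_of_bool _)%:R.
apply/eqP/andP => [/esym e0|[/eqP <- /eqP <-]]; last by rewrite addr0.
have l0 := regular_chart_unit rl rk e0.
by move: e0; rewrite l0 add0r => ->; rewrite eqxx.
Qed.

Lemma locally_free_dual (E : eqsheaf C n) : locally_free E ->
  exists N (y : 'I_N -> sec E I) (mu : 'I_N -> weight n)
    (phi : 'I_N -> sec E I -> regfun C I),
  [/\ forall j, wspace (mu j) (y j), forall j, linear (phi j),
      forall j a m, regular I a -> phi j (xact a m) = xact a (phi j m)
    & forall m, m = \sum_j funact (phi j m) (y j)].
Proof.
move=> /(_ I)[r [g [phi [lphi xphi hm]]]].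
have [N [idx [y [mu [hy hf]]]]] := homogeneous_generators g.
exists N, y, mu, (fun j => phi (idx j)); split=> //.
- by move=> j a m; apply: xphi.
- by move=> m; rewrite {1}(hm m) hf.
Qed.

(** P lists the weights [mu j] of a homogeneous dual basis of E, each with the constant term of
    [phi j (y j)]. For the tensor product these constants multiply and the weights add. *)
Lemma wdim_tensor (E : eqsheaf C n) : locally_free E ->
  exists P : seq (C * weight n),
  (forall (E' : cohsheaf C n) x, csheaf E' = E -> (wdim E' I x)%:R =
     \sum_(p <- P) p.1 * (regular I (wexp (x - p.2)))%:R) /\
  forall (F H : cohsheaf C n) x, locally_free F -> is_tensor E F H ->
    (wdim H I x)%:R = \sum_(p <- P) p.1 * (wdim F I (x - p.2))%:R.
Proof.
move=> lE; have [N [y [mu [phi [hy lphi xphi hm]]]]] := locally_free_dual lE.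
pose c j := mon_coef 0 (phi j (y j)).
exists [seq (c j, mu j) | j <- index_enum 'I_N].
have hc j a : regular I a -> mon_coef a (phi j (xact a (y j))) = c j.
  by move=> ra; rewrite xphi // -{1}[a]add0r mon_coef_xact.
split=> [E' x eE|F H x lF].
  rewrite big_map; subst E; exact: (wdim_dual _ hy lphi hm hc).
have [N' [y' [mu' [phi' [hy' lphi' xphi' hm']]]]] := locally_free_dual lF.
pose c' j := mon_coef 0 (phi' j (y' j)).
have hc' j a : regular I a -> mon_coef a (phi' j (xact a (y' j))) = c' j.
  by move=> ra; rewrite xphi' // -{1}[a]add0r mon_coef_xact.
move=> [beta [bil bx bt _ univ]].
have [bl br] := bil I.
(* Products of coordinate functions are balanced over O(U_i), so they descend to H and are dual to
   the vectors [z p] below. *)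
pose gam (p : 'I_N * 'I_N') (m : sec E I) (m' : sec F I) : regfun C I :=
  funact (phi p.1 m) (phi' p.2 m').
have gl p m : linear (gam p m).
  by move=> a u v; rewrite /gam lphi' funact_linearr.
have gr p m' : linear (gam p ^~ m').
  by move=> a u v; rewrite /gam lphi funact_linear.
have gx p a m m' : regular I a -> gam p (xact a m) m' = gam p m (xact a m').
  move=> ra; rewrite /gam (xphi _ _ _ ra) (xphi' _ _ _ ra).
  rewrite (funact_xactl (phi p.1 m) (phi' p.2 m') ra).
  by rewrite (funact_xactr (phi p.1 m) (phi' p.2 m') ra).
have /choice[h hP] : forall p, exists h : sec H I -> regfun C I,
    linear h /\ forall m m', h (beta I m m') = gam p m m'.
  by move=> p; have [h [hh _]] := univ I _ _ (gl p) (gr p) (gx p); exists h.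
pose z p := beta I (y p.1) (y' p.2).
have bfl f m m' : beta I (funact f m) m' = funact f (beta I m m').
  rewrite !funactE (lin_sum _ _ _ (br m')); apply: eq_bigr => k _.
  by rewrite (linZ _ _ (br m')) (bx _ _ _ _ (regs_regular k)).1.
have bfr f m m' : beta I m (funact f m') = funact f (beta I m m').
  rewrite !funactE (lin_sum _ _ _ (bl m)); apply: eq_bigr => k _.
  by rewrite (linZ _ _ (bl m)) (bx _ _ _ _ (regs_regular k)).2.
(* [beta] itself factors through a unique linear map on H, and both the identity and the expansion
   on the [z p] are such factorizations. *)
have span m : m = \sum_p funact (h p m) (z p).
  have [k [_ uk]] := univ I _ (beta I) bl br
    (fun a m m' ra => etrans (bx I a m m' ra).1 (esym (bx I a m m' ra).2)).
  have e1 : k = id by apply: uk; split=> //.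
  have e2 : k = fun m => \sum_p funact (h p m) (z p).
    apply: uk; split=> [a u v|m1 m2].
      rewrite scaler_sumr -big_split /=; apply: eq_bigr => p _.
      by rewrite (hP p).1 funact_linear.
    rewrite {2}(hm m1) {2}(hm' m2) (lin_sum _ _ _ (br _)).
    under [RHS]eq_bigr do rewrite (lin_sum _ _ _ (bl _)).
    rewrite pair_bigA /=; apply: eq_bigr => p _.
    by rewrite (hP p).2 funactA bfl bfr.
  by rewrite -{1}[m]/(id m) -e1 e2.
rewrite (@wdim_dual C n H I _ z (fun p => mu p.1 + mu' p.2) h
  (fun p => c p.1 * c' p.2) x) //.
- rewrite big_map -(pair_bigA _ (fun j l => c j * c' l *
      (regular I (wexp (x - (mu j + mu' l))))%:R)) /=.
  apply: eq_bigr => j _; rewrite (@wdim_dual C n F I _ y' mu' phi' c') //.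
  by rewrite mulr_sumr; apply: eq_bigr => l _; rewrite opprD addrA mulrA.
- move=> p t tt; rewrite /z bt // hy // hy' //.
  by rewrite (linZ _ _ (br _)) (linZ _ _ (bl _)) scalerA wcharD.
- by move=> p; case: (hP p).
move=> p a ra; rewrite /z -(bx _ _ _ _ ra).1 (hP p).2 /gam (xphi _ _ _ ra).
rewrite (funact_xactl (phi p.1 (y p.1)) (phi' p.2 (y' p.2)) ra).
by rewrite -{1}[a]add0r mon_coef_xact // mon_coef0M.
Qed.

End Bundles.

(** * Weight spaces of the structure sheaves of the X_u *)

Section StructureSheaves.
Variables (C : numFieldType) (n : nat) (u : 'I_n.+1) (I : opens n).
Local Notation expo := {ffun 'I_n.+1 -> int}.
Local Notation mons := {a : expo | xmon u I a}.

Lemma mcoeff_otact t (m : {malg C[mons]}) (k : mons) :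
  (otact t (m : osec C u I) : {malg C[mons]})@_k = tpow t (- val k) * m@_k.
Proof.
have l1 : linear (fun m : {malg C[mons]} =>
    (otact t (m : osec C u I) : {malg C[mons]})@_k : C^o).
  by move=> c f g; rewrite /otact mlift_linear mcoeffD mcoeffZ.
have l2 : linear (fun m : {malg C[mons]} => tpow t (- val k) * m@_k : C^o).
  by move=> c f g; rewrite mcoeffD mcoeffZ mulrDr mulrCA.
apply: (eq_linear_malg l1 l2) => l.
rewrite /otact mliftU -omonE mcoeffZ mcoeffU.
by have [->|] := eqVneq l k; rewrite ?mulr0.
Qed.

Lemma wspace_OX x (m : {malg C[mons]}) (k : mons) :
  @wspace C n (OX C u) I x m -> m@_k != 0 -> val k = wexp x.
Proof.
move=> hm mk; have rk : regular I (val k) by have /andP[] := valP k.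
have [sk _] := andP rk.
rewrite -(wexp_wt (eqP sk)); congr wexp.
apply/eqP; apply: contraT => /(wchar_sep C)[t tt] /eqP; case.
have := congr1 (fun f : {malg C[mons]} => f@_k) (hm t tt).
rewrite [LHS]mcoeff_otact mcoeffZ -wtN wchar_wt // => /(mulIf mk).
by [].
Qed.

(** The class of x^a has weight -a, which determines a. So the weight space is at most a line,
    spanned by the monomial [wexp x] when that survives on X_u. *)
Lemma wdim_OX x : wdim (OX C u) I x = xmon u I (wexp x) :> nat.
Proof.
apply: wdimE; case: (boolP (xmon u I (wexp x))) => xx /=; last first.
  exists (fun _ => 0); split=> [[]//|c _|m hm]; first by apply/rowP => -[].
  exists 0; rewrite /lincomb big_ord0; apply/malgP => k; rewrite mcoeff0.
  apply/eqP; apply: contraT => mk.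
  by have := valP k; rewrite (wspace_OX hm mk) (negbTE xx).
pose s : mons := Sub (wexp x) xx.
pose e : {malg C[mons]} := << 1 *g s >>.
exists (fun _ => e); split.
- move=> k t tt; apply/malgP => l.
  rewrite [LHS]mcoeff_otact [RHS]mcoeffZ mcoeffU.
  have [<-|] := eqVneq s l; last by rewrite !mulr0.
  by rewrite -wchar_wt // wtN wt_wexp opprK.
- move=> c; rewrite /lincomb big_ord1 => /malgP/(_ s).
  rewrite [LHS]mcoeffZ mcoeffUU mulr1 mcoeff0 => c0.
  by apply/rowP => k; rewrite ord1 mxE.
move=> m hm; exists (const_mx ((m : {malg C[mons]})@_s)).
rewrite /lincomb big_ord1 mxE; apply/malgP => k.
rewrite [RHS]mcoeffZ mcoeffU; have [<-|ks] := eqVneq s k; first by rewrite mulr1.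
rewrite mulr0; apply/eqP; apply: contraT => mk.
by rewrite -val_eqE /= -(wspace_OX hm mk) eqxx in ks.
Qed.

End StructureSheaves.

(** * The action of R(T) on formal characters *)

Section Act.
Variables (C : numFieldType) (n : nat).
Implicit Types (g h : RT n) (f : weight n -> C) (P : seq (C * weight n)).

(** Convolution, e^y acting as translation by y. Formal characters are arbitrary functions on the
    weights, since their support may be infinite. *)
Definition act g f x : C := \sum_(y <- msupp g) (g@_y)%:~R * f (x - y).

Lemma act_widen (d : {fset weight n}) g f x : (msupp g `<=` d)%fset ->
  act g f x = \sum_(y <- d) (g@_y)%:~R * f (x - y).
Proof.
move=> le_d; apply: (big_fset_incl _ le_d) => y _ /mcoeff_outdom ->.
by rewrite mul0r.
Qed.

Lemma actD g h f x : act (g + h) f x = act g f x + act h f x.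
Proof.
rewrite (act_widen _ _ (msuppD_le g h)) (act_widen f x (fsubsetUl (msupp g) (msupp h))).
rewrite (act_widen f x (fsubsetUr (msupp g) (msupp h))) -big_split /=.
by apply: eq_bigr => y _; rewrite mcoeffD intrD mulrDl.
Qed.

Lemma actU c (y : weight n) f x : act << c *g y >> f x = c%:~R * f (x - y).
Proof. by rewrite (act_widen _ _ msuppU_le) big_seq_fset1 mcoeffUU. Qed.

Lemma act0 f x : act 0 f x = 0.
Proof. by rewrite /act msupp0 big_seq_fset0. Qed.

Lemma act1 f x : act 1 f x = f x.
Proof. by rewrite actU mul1r subr0. Qed.

Lemma actN g f x : act (- g) f x = - act g f x.
Proof. by apply/eqP; rewrite -addr_eq0 -actD addNr act0. Qed.

Lemma act_exp (y : weight n) f x : act (grexp y) f x = f (x - y).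
Proof. by rewrite [LHS]actU mul1r. Qed.

Lemma act1Bexp (y : weight n) f x : act (1 - grexp y) f x = f x - f (x - y).
Proof. by rewrite [LHS]actD [X in X + _ = _]act1 [X in _ + X = _]actN act_exp. Qed.

Lemma actM g h f : act (g * h) f = act g (act h f).
Proof.
apply/funext => x; move: g; apply: grind => [|g1 g2 e1 e2|c k].
- by rewrite mul0r !act0.
- rewrite (mulrDl g1 g2 h) [LHS]actD [RHS]actD.
  exact: congr2 e1 e2.
rewrite actU; move: h; apply: grind => [|h1 h2 e1 e2|c' k'].
- by rewrite mulr0 !act0 mulr0.
- rewrite (mulrDr (<< c *g k >> : RT n) h1 h2) [LHS]actD [in RHS]actD [RHS]mulrDr.
  exact: congr2 e1 e2.
have -> : (<< c *g k >> : RT n) * << c' *g k' >> = << c * c' *g (k + k') >>.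
  exact: grmulUU.
by rewrite [LHS]actU [in RHS]actU intrM opprD addrA mulrA.
Qed.

Lemma act_sum (T : Type) (r : seq T) (g : T -> RT n) f x :
  act (\sum_(j <- r) g j) f x = \sum_(j <- r) act (g j) f x.
Proof. by elim: r => [|j r IH]; rewrite ?big_nil ?act0 // !big_cons actD IH. Qed.

(* Same as [act], for formal sums of characters with coefficients in C. *)
Definition cact P f x : C := \sum_(p <- P) p.1 * f (x - p.2).

Lemma act_cact g P f : act g (cact P f) = cact P (act g f).
Proof.
apply/funext => x; rewrite /act /cact.
under eq_bigr do rewrite mulr_sumr.
rewrite exchange_big /=; apply: eq_bigr => p _.
by rewrite mulr_sumr; apply: eq_bigr => y _; rewrite mulrCA addrAC.
Qed.

End Act.

(** * Formal characters of polynomial rings on a chart *)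

Section ChartCharacters.
Variables (C : numFieldType) (n : nat) (i : 'I_n.+1).
Local Notation expo := {ffun 'I_n.+1 -> int}.
Implicit Types (J A : {set 'I_n.+1}).

(* The character of the polynomial ring in the x_j / x_i for j in J. *)
Definition polychar J (x : weight n) : C :=
  ((\sum_l wexp x l == 0) && [forall k, (k != i) ==>
     (if k \in J then 0 <= wexp x k else wexp x k == 0)])%:R.

(** x_j / x_i has weight eps_i - eps_j, so for j distinct from i the factor of j inverts the
    character of C[x_j / x_i]. *)
Definition denom A : RT n :=
  \prod_(j in A) (1 - grexp (eps n i.+1 - eps n j.+1)).

(** The multiples of x_j / x_i are subtracted: among the exponents of x_j that are at least 0, only
    0 is not at least 1. *)
Lemma denom1_polychar J (j : 'I_n.+1) : j != i -> j \notin J ->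
  act (1 - grexp (eps n i.+1 - eps n j.+1)) (polychar (j |: J)) = polychar J.
Proof.
move=> ji jJ; apply/funext => x; rewrite act1Bexp.
pose e (l : 'I_n.+1) : expo := [ffun k : 'I_n.+1 => (k == l)%:Z].
have eE (l : 'I_n.+1) : eps n l.+1 = wt (e l).
  by rewrite /eps; congr wt; apply/ffunP => k; rewrite !ffunE eqSS.
have se l : \sum_k e l k = 1.
  rewrite (bigD1 l) //= ffunE eqxx big1 ?addr0 // => k /negbTE kl.
  by rewrite ffunE kl.
have sd : \sum_k (e j - e i) k = 0.
  under eq_bigr do rewrite !ffunE.
  rewrite -[RHS](subrr 1) -{1}(se j) -(se i) -sumrB.
  by apply: eq_bigr => k _; rewrite !ffunE.
rewrite /polychar !eE opprB -wtN -wtD wexpB //.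
have -> : \sum_l (wexp x - (e j - e i)) l = \sum_l wexp x l.
  under eq_bigr do rewrite ffunE [X in _ + X]ffunE.
  by rewrite big_split /= sumrN sd subr0.
case: (_ == 0) => /=; last by rewrite subrr.
pose R k := if k \in J then 0 <= wexp x k else wexp x k == 0.
have split_j (b : bool) (Q : pred 'I_n.+1) :
    (forall k, k != i -> Q k = if k == j then b else R k) ->
    [forall k, (k != i) ==> Q k] = b && [forall k, (k != i) && (k != j) ==> R k].
  move=> hQ; apply/forallP/andP => [h|[hb /forallP h] k].
    split; first by have := h j; rewrite ji hQ // eqxx.
    apply/forallP => k; apply/implyP => /andP[ki /negbTE kj].
    by have := h k; rewrite ki hQ // kj.
  apply/implyP => ki; rewrite hQ //; case: eqP => // /eqP kj.
  by have := h k; rewrite ki kj.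
rewrite (split_j (0 <= wexp x j)); last first.
  by move=> k ki; rewrite !inE; case: (eqVneq k j) => //= ->.
rewrite (split_j (1 <= wexp x j)); last first.
  move=> k ki; rewrite !inE /R !ffunE (negbTE ki) subr0.
  by case: (eqVneq k j) => [->|kj] /=; rewrite ?subr_ge0 ?subr0.
rewrite (split_j (wexp x j == 0)); last first.
  by move=> k ki; rewrite /R; case: (eqVneq k j) => // ->; rewrite (negbTE jJ).
case: [forall k, _]; rewrite ?andbF ?subrr // !andbT.
case: (wexp x j) => [[|k]|k] //=; by rewrite ?subr0 ?subrr.
Qed.

Lemma denom_polychar A J : i \notin A -> A \subset J ->
  act (denom A) (polychar J) = polychar (J :\: A).
Proof.
have [k] := ubnP #|A|; elim: k A => // k IH A kA iA AJ.
have [->|[j jA]] := set_0Vmem A.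
  rewrite /denom big_set0 setD0; apply/funext => x; exact: act1.
have ji : j != i by apply: contraNneq iA => <-.
rewrite -(setD1K jA) /denom big_setU1 ?setD11 //= actM IH.
- rewrite -[RHS](@denom1_polychar _ j) ?inE ?eqxx //; congr (act _ (polychar _)).
  apply/setP => l; rewrite !inE; case: (eqVneq l j) => //= ->.
  by rewrite (subsetP AJ).
- by rewrite (cardsD1 j) jA in kA.
- by rewrite inE (negbTE iA) andbF.
- exact: subset_trans (subsetDl _ _) AJ.
Qed.

Lemma polychar1 x : polychar [set i] x = (x == 0)%:R.
Proof.
rewrite /polychar; congr (nat_of_bool _)%:R; apply/andP/eqP => [[/eqP s0 /forallP h]|->].
  suff e : wexp x = 0 by apply/eqP; rewrite -oppr_eq0 -wt_wexp e wt0.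
  have hk k : k != i -> wexp x k = 0.
    by move=> ki; have := h k; rewrite inE ki (negbTE ki) => /eqP.
  apply/ffunP => k; rewrite [RHS]ffunE; have [->|] := eqVneq k i; last exact: hk.
  by rewrite (bigD1 i) //= big1 ?addr0 in s0.
rewrite wexp0; split; first by rewrite big1 // => k _; rewrite ffunE.
by apply/forallP => k; rewrite ffunE lexx eqxx if_same implybT.
Qed.

(** [polychar [set i]] is the character of the constants, the unit of convolution. Acting on it
    reads off the coefficients of g, and the integers embed in C. *)
Lemma act_delta_inj (g : RT n) : act g (polychar [set i]) = (fun=> 0) -> g = 0.
Proof.
move=> e; apply/malgP => k; rewrite mcoeff0; apply/eqP.
rewrite -(intr_eq0 C) -[X in X == _]mulr1; apply/eqP.
have := congr1 (fun f => f k) e; rewrite /act => <-.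
case: msuppP => [kg|kg]; last first.
  rewrite mul0r big_seq big1 // => y yg; rewrite polychar1 subr_eq0.
  by case: eqP => [ky|_]; [rewrite ky yg in kg|rewrite mulr0].
rewrite (bigD1_seq k) //= polychar1 subrr eqxx big1 ?addr0 // => y yk.
by rewrite polychar1 subr_eq0 eq_sym (negbTE yk) mulr0.
Qed.

Lemma denomC_polychar : act (denom [set~ i]) (polychar setT) = polychar [set i].
Proof. by rewrite denom_polychar ?inE ?eqxx ?subsetT // setTD setCK. Qed.

Lemma act_polychar_inj (g : RT n) : act g (polychar setT) = (fun=> 0) -> g = 0.
Proof.
move=> h; apply: act_delta_inj.
rewrite -denomC_polychar -actM mulrC actM h; apply/funext => x.
by rewrite /act big1 // => y _; rewrite mulr0.
Qed.

(** [denom A] divides the product over all j distinct from i, which sends the character of O(U_i) to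
    that of the constants; so g kills the latter. *)
Lemma denom_lreg A (g : RT n) : i \notin A -> denom A * g = 0 -> g = 0.
Proof.
move=> iA h; apply: act_delta_inj; rewrite -denomC_polychar -actM.
have -> : g * denom [set~ i] = 0; last by apply/funext => x; exact: act0.
rewrite mulrC /denom (bigID (mem A)) /= (eq_bigl (mem A)).
  by rewrite mulrAC [X in X * _]h mul0r.
move=> j; rewrite !inE; case: (boolP (j \in A)) => jA; rewrite ?andbF ?andbT //.
by apply: contraNneq iA => <-.
Qed.

End ChartCharacters.

(** * Localization at a fixed point *)

Section Localization.
Variables (C : numFieldType) (n : nat) (i : 'I_n.+1).
Local Notation I := (chart i).
Implicit Types (X Y : KT C n) (x : weight n).

Definition Kchar X x : C := \sum_(p <- X) p.1%:~R * (wdim p.2 I x)%:R.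

(** Apart from the group laws, the only relation comes from exact sequences, where [wdim_exact]
    applies. *)
Lemma Keq_Kchar X Y : Keq X Y -> Kchar X = Kchar Y.
Proof.
move=> e; apply/funext => x; elim: e => {X Y}.
- by [].
- by move=> X Y _ ->.
- by move=> X Y Z _ -> _ ->.
- move=> X X' Y Y' _ e1 _ e2; rewrite /Kchar !big_cat /=.
  by rewrite -/(Kchar _ _) e1 -/(Kchar _ _) e2.
- by move=> X Y; rewrite /Kchar !big_cat /= addrC.
- by move=> F; rewrite /Kchar big_seq1 big_nil mul0r.
- by move=> k l F; rewrite /Kchar big_cons !big_seq1 intrD mulrDl.
move=> k F' F F'' ex; rewrite /Kchar big_seq1 big_cons big_seq1 /=.
by rewrite (wdim_exact I x ex) natrD mulrDr.
Qed.

Lemma Kchar_scale (c : RT n) X : Kchar (Kscale c X) = act c (Kchar X).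
Proof.
apply/funext => x; rewrite /Kchar /Kscale big_allpairs_dep /=; apply: eq_bigr => l _.
rewrite mulr_sumr; apply: eq_bigr => p _ /=.
by rewrite intrM mulrA wdim_twist.
Qed.

Lemma Kchar_sum (F : 'I_n.+1 -> KT C n) x : Kchar (Ksum F) x = \sum_w Kchar (F w) x.
Proof. by rewrite /Kchar /Ksum big_flatten big_map big_enum. Qed.

(** X_u misses the chart when i > u; otherwise the variables x_j / x_i with j > u drop out. *)
Lemma xmon_chart (u : 'I_n.+1) x : (xmon u I (wexp x))%:R =
  (u >= i)%:R * polychar C i [set j : 'I_n.+1 | (j <= u)%N] x.
Proof.
rewrite /polychar -natrM mulnb; congr (nat_of_bool _)%:R.
rewrite /xmon /regular andbCA -andbA; congr (_ && _).
apply/andP/andP => [[/forallP h1 /forallP h2]|[iu /forallP h]].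
  split; first by rewrite leqNgt; apply/negP => ui; have := h2 i; rewrite ui /= inE eqxx.
  apply/forallP => k; apply/implyP => ki; rewrite inE.
  case: (leqP k u) => ku; first by have := h1 k; rewrite /= inE ki implyTb.
  by have := h2 k; rewrite ku /= => /andP[].
split; apply/forallP => k; apply/implyP.
  by rewrite /= inE => ki; have := h k; rewrite ki /= inE; case: ifP => // _ /eqP ->.
move=> uk; have ki : k != i by apply: contraTneq uk => ->; rewrite -leqNgt.
by rewrite /= inE ki; have := h k; rewrite ki inE leqNgt uk.
Qed.

(* The restriction to the i-th fixed point of the class of X_u. *)
Definition fixclass (u : 'I_n.+1) : RT n :=
  if (i <= u)%N then denom i [set j : 'I_n.+1 | (u < j)%N] else 0.

Lemma Kchar_OX u : Kchar (Kcl (OX C u)) = act (fixclass u) (polychar C i setT).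
Proof.
apply/funext => x; rewrite /Kchar big_seq1 mul1r wdim_OX xmon_chart /fixclass.
case: leqP => iu; last by rewrite mul0r act0.
rewrite mul1r denom_polychar ?subsetT //; last by rewrite inE -leqNgt.
by congr polychar; apply/setP => j; rewrite !inE andbT -leqNgt.
Qed.

(** P depends on X alone and serves for every Y: it collects, with multiplicities, the sums given by
    [wdim_tensor]. *)
Lemma Kchar_bundles X : Kbundles X -> exists P : seq (C * weight n),
  Kchar X = cact P (polychar C i setT) /\
  forall Y (tens : cohsheaf C n -> cohsheaf C n -> cohsheaf C n),
    Kbundles Y ->
    (forall E F : cohsheaf C n, locally_free E -> locally_free F ->
       is_tensor E F (tens E F)) ->
    Kchar [seq (a.1 * c.1, tens a.2 c.2) | a <- X, c <- Y] = cact P (Kchar Y).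
Proof.
elim: X => [_|[k E] X IH /= [lE /IH[P [e1 e2]]]].
  exists [::]; split=> [|Y tens _ _]; apply/funext => x;
  by rewrite /Kchar /cact /= !big_nil.
have [Q [f1 f2]] := wdim_tensor i lE.
exists ([seq (k%:~R * q.1, q.2) | q <- Q] ++ P); split=> [|Y tens lY ht];
  apply/funext => x; rewrite /cact big_cat big_map /=.
  rewrite -/(cact P _ x) -e1 /Kchar big_cons; congr (_ + _) => /=.
  rewrite (f1 E x erefl) mulr_sumr; apply: eq_bigr => q _.
  rewrite mulrA; congr (_ * _); rewrite -xmon_max xmon_chart -ltnS ltn_ord mul1r.
  by congr polychar; apply/setP => j; rewrite !inE -ltnS ltn_ord.
rewrite -/(cact P _ x) -(e2 _ _ lY ht) /Kchar big_cat /= big_map; congr (_ + _).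
elim: Y lY {e2} => [_|[l F] Y IHY /= [lF lY]].
  by rewrite big_nil big1 // => q _; rewrite big_nil mulr0.
rewrite big_cons IHY //=; under [RHS]eq_bigr do rewrite big_cons mulrDr.
rewrite big_split /=; congr (_ + _).
rewrite (f2 F _ x lF (ht _ _ lE lF)) intrM mulr_sumr; apply: eq_bigr => q _.
by rewrite mulrACA !mulrA.
Qed.

Lemma fixclass_structure b : @structure_constants C n b ->
  forall u v, \sum_w b u v w * fixclass w = fixclass u * fixclass v.
Proof.
move=> hb u v; have [p [q [tens [lp lq ht [hp hq] hz]]]] := hb u v.
have [P [e1 e2]] := Kchar_bundles lp.
apply/eqP; rewrite -subr_eq0; apply/eqP; apply: (@act_polychar_inj C n i).
apply/funext => x; rewrite actD actN; apply/eqP; rewrite subr_eq0; apply/eqP.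
have -> : act (fixclass u * fixclass v) (polychar C i setT) =
    Kchar (Ksum (fun w => Kscale (b u v w) (Kcl (OX C w)))).
  (* The product has P times the character of X_v. Moving P past [fixclass v] makes it meet the
     character of O(U_i), which gives that of X_u. *)
  rewrite (Keq_Kchar hz) (e2 _ _ lq ht) -(Keq_Kchar hq) Kchar_OX -act_cact -e1.
  by rewrite -(Keq_Kchar hp) Kchar_OX -actM mulrC.
rewrite Kchar_sum act_sum; apply: eq_bigr => w _.
by rewrite Kchar_scale Kchar_OX -actM.
Qed.

End Localization.

(** * Newton interpolation and power series *)

Section PowerSeriesRing.
Variable A : comNzRingType.
Implicit Types (f g h : pseries A).

Let trunc N f : {poly A} := \poly_(i < N) f i.

(** A coefficient of a product depends only on truncations, so the ring laws are inherited from
    polynomials. *)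
Let psmul_trunc N f g p : (p < N)%N -> psmul f g p = (trunc N f * trunc N g)`_p.
Proof.
move=> pN; rewrite coefM; apply: eq_bigr => i _; rewrite !coef_poly.
by rewrite (leq_trans _ pN) ?ltn_ord // (leq_ltn_trans (leq_subr _ _) pN).
Qed.

Lemma psmulA : associative (@psmul A).
Proof.
move=> f g h; apply/funext => p.
rewrite (@psmul_trunc p.+1 f) // (@psmul_trunc p.+1 (psmul f g)) //.
have -> : (trunc p.+1 f * trunc p.+1 (psmul g h))`_p =
    (trunc p.+1 f * (trunc p.+1 g * trunc p.+1 h))`_p.
  rewrite !coefM; apply: eq_bigr => i _; congr (_ * _).
  by rewrite [LHS]coef_poly ltnS leq_subr (@psmul_trunc p.+1) // ltnS leq_subr.
rewrite mulrA !(coefM _ (trunc p.+1 h)); apply: eq_bigr => i _; congr (_ * _).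
by rewrite [RHS]coef_poly ltn_ord (@psmul_trunc p.+1).
Qed.

Lemma psmulC : commutative (@psmul A).
Proof. by move=> f g; apply/funext => p; rewrite !(@psmul_trunc p.+1) // mulrC. Qed.

Lemma psmul1 : left_id (@psone A) (@psmul A).
Proof.
move=> f; apply/funext => p; rewrite /psmul big_ord_recl subn0 /psone /= mul1r.
by rewrite big1 ?addr0 // => i _; rewrite mul0r.
Qed.

HB.instance Definition _ := Monoid.isComLaw.Build (pseries A) (@psone A) (@psmul A)
  psmulA psmulC psmul1.

Lemma psmul_pslin f x p :
  psmul f (pslin x) p = f p - (if p is q.+1 then x * f q else 0).
Proof.
rewrite psmulC /psmul big_ord_recl subn0 /pslin /= subr0 mul1r; congr (_ + _).
case: p => [|p]; first by rewrite big_ord0 oppr0.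
rewrite big_ord_recl /= big1 => [|i _]; last by rewrite /= subrr mul0r.
by rewrite addr0 sub0r mulr1n subn1 mulNr.
Qed.

Variable x : nat -> A.

Definition lins w : pseries A := \big[@psmul A/@psone A]_(1 <= i < w.+1) pslin (x i).
(** The coefficient of t^p is the complete homogeneous symmetric polynomial h_p(x_1, ..., x_w). *)
Definition geoms w : pseries A := \big[@psmul A/@psone A]_(1 <= i < w.+1) psgeom (x i).
Definition newton w (z : A) : A := \prod_(1 <= i < w.+1) (z - x i).

Lemma newtonS w z : newton w.+1 z = newton w z * (z - x w.+1).
Proof. by rewrite /newton big_nat_recr. Qed.

Lemma newton0 z : newton 0 z = 1.
Proof. by rewrite /newton big_geq. Qed.

Lemma lins0 : lins 0 = @psone A.
Proof. by rewrite /lins big_geq. Qed.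

Lemma linsS w : lins w.+1 = psmul (lins w) (pslin (x w.+1)).
Proof. by rewrite /lins big_nat_recr. Qed.

Lemma geoms_at0 w : geoms w 0%N = 1.
Proof.
elim: w => [|w IH]; first by rewrite /geoms big_geq.
rewrite /geoms big_nat_recr //= -/(geoms w).
by rewrite [LHS]big_ord1 /= IH mul1r.
Qed.

Lemma geomsS w p : geoms w.+1 p.+1 = geoms w p.+1 + x w.+1 * geoms w.+1 p.
Proof.
have <- : psmul (geoms w.+1) (pslin (x w.+1)) = geoms w.
  rewrite /geoms big_nat_recr //= -psmulA (psmulC (psgeom _)).
  have -> : psmul (pslin (x w.+1)) (psgeom (x w.+1)) = @psone A.
    by apply/funext => q; exact: pslinK.
  by rewrite psmulC psmul1.
by rewrite psmul_pslin subrK.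
Qed.

(** The divided difference of z^m at x_1, ..., x_{w+1} is h_{m-w}. The induction on m uses z N_w =
    N_{w+1} + x_{w+1} N_w and [geomsS]. *)
Lemma newton_exp z m : z ^+ m = \sum_(w < m.+1) geoms w.+1 (m - w)%N * newton w z.
Proof.
elim: m => [|m IH].
  by rewrite big_ord1 geoms_at0 newton0 mulr1.
rewrite exprS {}IH mulr_sumr.
have step w : z * newton w z = newton w.+1 z + x w.+1 * newton w z.
  by rewrite newtonS; ring.
under eq_bigr do rewrite mulrCA step mulrDr.
rewrite big_split /= [RHS]big_ord_recr /= subnn geoms_at0 -(geoms_at0 m.+1).
under [in RHS]eq_bigr => w _.
  rewrite (subSn (leq_ord w)) geomsS mulrDl; over.
rewrite big_split /= addrAC; congr (_ + _); last first.
  by apply: eq_bigr => w _; rewrite mulrCA mulrA.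
pose F w := geoms w (m.+1 - w)%N * newton w z.
transitivity (\sum_(w < m.+2) F w).
  have F0 : F 0%N = 0.
    by rewrite /F /geoms big_geq // subn0 /psone /= mul0r.
  rewrite [RHS]big_ord_recl [F _]F0 add0r.
  by apply: eq_bigr => w _; rewrite /F lift0 subSS.
rewrite [LHS]big_ord_recr /F subnn; congr (_ + _).
by apply: eq_bigr => w _; rewrite (subSn (leq_ord w)).
Qed.

(* The value at z of the polynomial of degree at most d whose reversal is f. *)
Definition rev_eval f d z : A := \sum_(k < d.+1) f k * z ^+ (d - k)%N.

Definition deg_le f d := forall k, (d < k)%N -> f k = 0.

(** Reversal turns the factor 1 - t y into z - y; the degree bound removes the coefficient of f at
    d+1. *)
Lemma rev_eval_pslin f d y z : deg_le f d ->
  deg_le (psmul f (pslin y)) d.+1 /\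
  rev_eval (psmul f (pslin y)) d.+1 z = rev_eval f d z * (z - y).
Proof.
move=> fd; split=> [[|k] // dk|].
  by rewrite psmul_pslin !fd ?mulr0 ?subrr // ltnW.
rewrite /rev_eval mulrBr !mulr_suml.
under eq_bigr do rewrite psmul_pslin mulrBl.
rewrite sumrB; congr (_ - _).
  rewrite big_ord_recr /= fd // mul0r addr0; apply: eq_bigr => k _.
  by rewrite -mulrA -exprSr (subSn (leq_ord k)).
rewrite big_ord_recl mul0r add0r; apply: eq_bigr => k _.
by rewrite lift0 subSS -mulrA mulrC.
Qed.

Lemma rev_eval_lins a b z : deg_le (psmul (lins a) (lins b)) (a + b) /\
  rev_eval (psmul (lins a) (lins b)) (a + b) z = newton a z * newton b z.
Proof.
elim: b => [|b [IH1 IH2]]; last first.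
  rewrite linsS psmulA addnS newtonS mulrA -IH2; exact: rev_eval_pslin.
rewrite lins0 newton0 psmulC psmul1 addn0 mulr1.
elim: a => [|a [IH1 IH2]]; last first.
  rewrite linsS newtonS -IH2; exact: rev_eval_pslin.
rewrite lins0 newton0 /rev_eval big_ord1 /psone mul1r; split=> //; by case.
Qed.

Lemma newton_mul a b z : newton a z * newton b z =
  \sum_(w < (a + b).+1)
    psmul (psmul (lins a) (lins b)) (geoms w.+1) (a + b - w)%N * newton w z.
Proof.
have [_ <-] := rev_eval_lins a b z; set f := psmul (lins a) (lins b).
move: (a + b)%N f => d f; rewrite /rev_eval.
under eq_bigr do rewrite newton_exp mulr_sumr.
under [RHS]eq_bigr do rewrite /psmul mulr_suml.
(* Both double sums run over the pairs with k + w <= d, and the coefficient of N_w is the sum of the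
   f_k h_{d-k-w}. *)
have widen (k : 'I_d.+1) (F : nat -> A) : \sum_(w < (d - k).+1) F w
    = \sum_(w < d.+1 | (k + w <= d)%N) F w.
  rewrite (big_ord_widen_cond d.+1 xpredT F) ?ltnS ?leq_subr //=.
  by apply: eq_bigl => w; rewrite ltnS leq_subRL ?leq_ord //.
under eq_bigr => k _ do
  rewrite (widen k (fun w => f k * (geoms w.+1 (d - k - w)%N * newton w z))).
under [RHS]eq_bigr => w _ do
  rewrite (widen w (fun k => f k * geoms w.+1 (d - w - k)%N * newton w z)).
rewrite (exchange_big_dep xpredT) //=; apply: eq_bigr => w _.
apply: eq_big => [k|k _]; first by rewrite addnC.
by rewrite mulrA -!subnDA addnC.
Qed.

End PowerSeriesRing.

(** * The longest element and the triangular system *)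

Section LongestElement.
Variable n : nat.
Local Notation expo := {ffun 'I_n.+1 -> int}.
Implicit Types (g h : RT n).

Definition rev_expo (a : expo) : expo := [ffun i => a (rev_ord i)].

Lemma wo_weight_wt a : wo_weight (wt a) = wt (rev_expo a).
Proof.
have [k hk] := repr_wt a; apply/wtP; exists k => i.
by rewrite !ffunE hk.
Qed.

Lemma wo_weightD (x y : weight n) : wo_weight (x + y) = wo_weight x + wo_weight y.
Proof.
rewrite -(wt_repr x) -(wt_repr y) -wtD !wo_weight_wt -wtD; congr wt.
by apply/ffunP => i; rewrite !ffunE.
Qed.

Lemma wo_weightN (x : weight n) : wo_weight (- x) = - wo_weight x.
Proof.
rewrite -(wt_repr x) -wtN !wo_weight_wt -wtN; congr wt.
by apply/ffunP => i; rewrite !ffunE.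
Qed.

Lemma wo_weight0 : wo_weight (0 : weight n) = 0.
Proof. by apply: (addIr (wo_weight 0)); rewrite -wo_weightD !add0r. Qed.

Lemma wo_eps (i : 'I_n.+1) : wo_weight (eps n (rev_ord i).+1) = eps n i.+1.
Proof.
rewrite /eps wo_weight_wt; congr wt; apply/ffunP => j; rewrite !ffunE.
by rewrite !eqSS (inj_eq val_inj) (inj_eq rev_ord_inj) (inj_eq val_inj).
Qed.

Lemma wo_widen (d : {fset weight n}) g : (msupp g `<=` d)%fset ->
  wo g = \sum_(y <- d) (<< g@_y *g wo_weight y >> : RT n).
Proof.
move=> le_d; apply: (big_fset_incl _ le_d) => y _ /mcoeff_outdom ->.
exact: monalgU0.
Qed.

Lemma woD g h : wo (g + h) = wo g + wo h.
Proof.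
rewrite (wo_widen (msuppD_le g h)) (wo_widen (fsubsetUl (msupp g) (msupp h))).
rewrite (wo_widen (fsubsetUr (msupp g) (msupp h))) -big_split /=.
by apply: eq_bigr => y _; rewrite mcoeffD; exact: monalgUD.
Qed.

Lemma woU c (y : weight n) : wo (<< c *g y >> : RT n) = << c *g wo_weight y >>.
Proof. by rewrite (wo_widen msuppU_le) big_seq_fset1 mcoeffUU. Qed.

Lemma wo0 : wo (0 : RT n) = 0.
Proof. by rewrite /wo msupp0 big_seq_fset0. Qed.

Lemma woN g : wo (- g) = - wo g.
Proof. by apply/eqP; rewrite -addr_eq0 -woD addNr wo0. Qed.

Lemma woM g h : wo (g * h) = wo g * wo h.
Proof.
move: g; apply: grind => [|g1 g2 e1 e2|c k].
- by rewrite mul0r wo0 mul0r.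
- rewrite (mulrDl g1 g2 h) [LHS]woD (woD g1 g2) [RHS]mulrDl.
  congr (_ + _); [exact: e1|exact: e2].
move: h; apply: grind => [|h1 h2 e1 e2|c' k'].
- by rewrite mulr0 wo0 mulr0.
- rewrite (mulrDr (<< c *g k >> : RT n) h1 h2) [LHS]woD (woD h1 h2) [RHS]mulrDr.
  congr (_ + _); [exact: e1|exact: e2].
have mU a b x y : (<< a *g x >> : RT n) * << b *g y >> = << a * b *g (x + y)%R >>.
  exact: grmulUU.
rewrite mU; apply: etrans (woU _ _) _; rewrite wo_weightD.
apply: etrans (esym (mU _ _ _ _)) _.
by congr (_ * _); apply/esym; exact: woU.
Qed.

Lemma wo1 : wo (1 : RT n) = 1.
Proof. by rewrite [LHS]woU wo_weight0. Qed.

Lemma wo_exp (x : weight n) : wo (grexp x) = grexp (wo_weight x).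
Proof. exact: woU. Qed.

Lemma wo_sum (T : Type) (r : seq T) (g : T -> RT n) :
  wo (\sum_(j <- r) g j) = \sum_(j <- r) wo (g j).
Proof. by elim: r => [|j r IH]; rewrite ?big_nil ?wo0 // !big_cons woD IH. Qed.

Lemma wo_prod (T : Type) (r : seq T) (P : pred T) (g : T -> RT n) :
  wo (\prod_(j <- r | P j) g j) = \prod_(j <- r | P j) wo (g j).
Proof.
elim: r => [|j r IH]; rewrite ?big_nil ?wo1 // !big_cons; case: ifP => // _.
by rewrite woM IH.
Qed.

Lemma grexpD (x y : weight n) : grexp (x + y) = grexp x * grexp y.
Proof. by rewrite [RHS]grmulUU mulr1. Qed.

Lemma denom_mem (i : 'I_n.+1) (A : {set 'I_n.+1}) : i \in A -> denom i A = 0.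
Proof.
have e (x : weight n) : x = 0 -> 1 - grexp x = 0 by move=> ->; exact: subrr.
move=> iA; rewrite /denom (bigD1 i) //=.
apply: etrans (mul0r _); congr (_ * _); exact: e (subrr _).
Qed.

(** Reversal turns j > n-w into j < w. For i < w the right-hand side contains the zero factor j = i,
    in agreement with the case distinction in [fixclass]. *)
Lemma wo_fixclass (i w : 'I_n.+1) :
  wo (fixclass (rev_ord i) (rev_ord w)) = denom i [set j : 'I_n.+1 | (j < w)%N].
Proof.
rewrite /fixclass; case: leqP => iw; last first.
  have wi : (i < w)%N by move: iw; rewrite /= ltn_sub2lE ?ltn_ord // ltnS.
  by rewrite wo0 denom_mem ?inE.
rewrite /denom wo_prod (reindex_inj rev_ord_inj); apply: eq_big => j.
  by rewrite !inE /= ltn_sub2lE ?ltn_ord // ltnS.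
move=> _; rewrite [LHS]woD [X in X + _ = _]wo1 [X in _ + X = _]woN wo_exp.
by rewrite wo_weightD wo_weightN !wo_eps.
Qed.

(** Strong induction on w with i = w: terms of smaller index vanish by induction, those of larger
    index contain the zero factor j = i, and the diagonal entry is not a zero divisor. *)
Lemma denom_triangular (d : 'I_n.+1 -> RT n) :
  (forall i, \sum_w d w * denom i [set j : 'I_n.+1 | (j < w)%N] = 0) ->
  forall w, d w = 0.
Proof.
move=> h w; have [k] := ubnP w; elim: k w => // k IH w wk.
have := h w; rewrite (bigD1 w) //= big1 ?addr0 => [|j jw].
  by rewrite mulrC; apply: (@denom_lreg rat); rewrite inE ltnn.
case: (ltngtP j w) => [jlt|wlt|/val_inj e]; last by rewrite e eqxx in jw.
  by rewrite IH ?mul0r // (leq_trans jlt).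
by rewrite denom_mem ?inE // mulr0.
Qed.

End LongestElement.

(** * The recursion *)

Lemma sum_ord_stable (V : nmodType) (m1 m2 : nat) (F : nat -> V) :
  (forall w, (m1 <= w)%N -> F w = 0) -> (forall w, (m2 <= w)%N -> F w = 0) ->
  \sum_(w < m1) F w = \sum_(w < m2) F w.
Proof.
suff h m k : (forall w, (m <= w)%N -> F w = 0) -> \sum_(w < m) F w = \sum_(w < m + k) F w.
  by move=> h1 h2; rewrite (h m1 m2) // (h m2 m1) // addnC.
move=> Fm; rewrite big_split_ord /= [X in _ + X]big1 ?addr0 // => i _.
by rewrite Fm // leq_addr.
Qed.

Section Recursion.
Variables (A : comNzRingType) (W : zmodType) (E : W -> A).
Hypotheses (E0 : E 0 = 1) (ED : forall x y, E (x + y) = E x * E y).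
Implicit Types (mu : nat -> W).

Definition wsum mu k : W := \sum_(1 <= i < k.+1) mu i.

(** The closed formula at natural indices, over an abstract ring with an exponential [E]; at [grexp]
    it is convertible to [rtilde_formula]. *)
Definition newton_coef mu (a b w : nat) : A :=
  if (w <= a + b)%N then
    E (wsum mu w - wsum mu a - wsum mu b) *
      psmul (psmul (lins (E \o mu) a) (lins (E \o mu) b))
        (geoms (E \o mu) w.+1) (a + b - w)%N
  else 0.

Lemma wsum0 mu : wsum mu 0 = 0.
Proof. by rewrite /wsum big_geq. Qed.

Lemma wsumS mu k : wsum mu k.+1 = wsum mu k + mu k.+1.
Proof. by rewrite /wsum big_nat_recr. Qed.

Lemma wsum_shift mu k : wsum mu k.+1 = mu 1%N + wsum (fun i => mu i.+1) k.
Proof. by rewrite /wsum big_ltn // big_add1. Qed.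

Lemma newton_shift mu k z :
  newton (E \o mu) k.+1 z = (z - E (mu 1%N)) * newton (E \o (fun i => mu i.+1)) k z.
Proof. by rewrite /newton big_ltn // big_add1. Qed.

Lemma ENK x : E (- x) * E x = 1.
Proof. by rewrite -ED addNr E0. Qed.

(** Each factor is - E(-mu_j) (E y - E mu_j), so the restrictions to fixed points are Newton
    polynomials up to sign and character. *)
Lemma prod_newton mu k y : \prod_(1 <= j < k.+1) (1 - E (y - mu j)) =
  (-1) ^+ k * (E (- wsum mu k) * newton (E \o mu) k (E y)).
Proof.
elim: k => [|k IH].
  by rewrite wsum0 big_geq // newton0 oppr0 E0 !mul1r.
rewrite big_nat_recr //= IH newtonS wsumS opprD !ED /= exprS.
rewrite -[X in X - E y * _](ENK (mu k.+1)); ring.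
Qed.

Lemma newton_root mu k j : (0 < j <= k)%N -> newton (E \o mu) k (E (mu j)) = 0.
Proof.
move=> /andP[j0 jk]; apply/eqP; rewrite /newton.
rewrite (bigD1_seq j) ?iota_uniq ?mem_index_iota ?j0 //=.
by rewrite subrr mul0r.
Qed.

Lemma newton_coef_sum mu a b z : \sum_(w < (a + b).+1)
    newton_coef mu a b w * (E (- wsum mu w) * newton (E \o mu) w z) =
  E (- wsum mu a - wsum mu b) * (newton (E \o mu) a z * newton (E \o mu) b z).
Proof.
rewrite newton_mul mulr_sumr; apply: eq_bigr => w _.
rewrite /newton_coef leq_ord !ED.
have := ENK (wsum mu w); set c := E (- wsum mu w); set d := E (wsum mu w) => cd.
set q := psmul _ _ _.
by rewrite -[RHS]mul1r -cd; ring.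
Qed.

(* The factor [E y - E (mu 1)] makes the terms with w >= n vanish, although the
   expansion of [newton a * newton b] may go beyond n. *)
Lemma newton_coef_shift mu n i a b : (0 < i <= n.+1)%N ->
  let mu' := fun j => mu j.+1 in
  \sum_(w < n) newton_coef mu' a b w *
     (E (- wsum mu w.+1) * newton (E \o mu) w.+1 (E (mu i))) =
  E (- mu 1%N - wsum mu' a - wsum mu' b) *
    ((E (mu i) - E (mu 1%N)) *
     (newton (E \o mu') a (E (mu i)) * newton (E \o mu') b (E (mu i)))).
Proof.
move=> /andP[i0 iN] mu'.
pose F w := newton_coef mu' a b w *
  (E (- wsum mu w.+1) * newton (E \o mu) w.+1 (E (mu i))).
rewrite (@sum_ord_stable _ n (a + b).+1 F).
- rewrite -!addrA ED; set z := E (mu i).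
  transitivity (E (- mu 1%N) * (z - E (mu 1%N)) *
    (E (- wsum mu' a - wsum mu' b) * (newton (E \o mu') a z * newton (E \o mu') b z))).
    rewrite -newton_coef_sum mulr_sumr; apply: eq_bigr => w _.
    by rewrite /F wsum_shift newton_shift opprD ED -/mu' -/z; ring.
  by ring.
- move=> w nw; rewrite /F newton_root ?mulr0 // i0 /=.
  exact: leq_trans iN _.
- by move=> w abw; rewrite /F /newton_coef leqNgt abw mul0r.
Qed.

Definition rec_coef mu (u v w : nat) : A :=
  let mu' := fun j => mu j.+1 in
  (E (mu u.+1 - mu 1%N) - 1) *
     (if (u, v, w) is (u'.+1, v'.+1, w'.+1) then newton_coef mu' u' v' w' else 0) +
  E (mu u.+1 - mu 1%N) *
     (if (v, w) is (v'.+1, w'.+1) then newton_coef mu' u v' w' else 0).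

(** By [newton_coef_shift] both parts of [rec_coef] sum to products of shifted Newton polynomials,
    which recombine through z - x_1 = (z - x_{u+1}) + (x_{u+1} - x_1). *)
Lemma rec_coef_newton mu n i u v : (0 < i <= n.+1)%N -> (0 < v)%N ->
  \sum_(w < n.+1) rec_coef mu u v w *
     (E (- wsum mu w) * newton (E \o mu) w (E (mu i))) =
  E (- wsum mu u - wsum mu v) *
    (newton (E \o mu) u (E (mu i)) * newton (E \o mu) v (E (mu i))).
Proof.
case: v => // v hi _; have cs a b := @newton_coef_shift mu n i a b hi.
rewrite /= in cs; set mu' := fun j => _ in cs.
(* The term w = 0 vanishes by the convention on negative indices. *)
rewrite big_ord_recl [X in X + _](_ : _ = 0) ?add0r; last first.
  by rewrite /rec_coef; case: u => [|u]; rewrite !mulr0 addr0 mul0r.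
set z := E (mu i); set D := E (mu u.+1 - mu 1%N).
transitivity ((D - 1) * (if u is u'.+1 then
    E (- mu 1%N - wsum mu' u' - wsum mu' v) *
    ((z - E (mu 1%N)) * (newton (E \o mu') u' z * newton (E \o mu') v z)) else 0)
  + D * (E (- mu 1%N - wsum mu' u - wsum mu' v) *
    ((z - E (mu 1%N)) * (newton (E \o mu') u z * newton (E \o mu') v z)))).
  rewrite -cs; case: u @D => [|u] D.
    rewrite mulr0 add0r mulr_sumr; apply: eq_bigr => w _.
    by rewrite lift0 /rec_coef /= mulr0 add0r -mulrA -/mu' -/D.
  rewrite -cs !mulr_sumr -big_split; apply: eq_bigr => w _.
  by rewrite lift0 /rec_coef /= -/D mulrDl -!mulrA.
have e1 := ENK (mu 1%N).
(* For u = 0 the factor D is [E 0] = 1, and only the second summand remains. *)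
case: u @D => [|u] D.
  rewrite /D subrr E0 mulr0 add0r mul1r wsum_shift newton_shift !newton0 -/mu' -/z.
  by rewrite !wsum0 subr0 oppr0 add0r opprD !mul1r.
have eu := ENK (mu u.+2).
rewrite (wsum_shift mu u) (wsum_shift mu v) (newton_shift mu u) (newton_shift mu v).
rewrite -/mu' newtonS wsumS -/z /D !opprD !ED /=.
rewrite -[mu' u.+1]/(mu u.+2).
set x := E (mu 1%N) in e1 *; set x' := E (- mu 1%N) in e1 *.
set y := E (mu u.+2) in eu *; set y' := E (- mu u.+2) in eu *.
set N1 := newton _ u z; set N2 := newton _ v z.
set a := E (- wsum mu' u); set b := E (- wsum mu' v).
(* Once y' y = 1, the last factor becomes x' z - 1 = x' (z - x), which supplies the second factor z
   - x_1. *)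
have -> : (y * x' - 1) * (x' * a * b * ((z - x) * (N1 * N2))) +
   y * x' * (x' * (a * y') * b * ((z - x) * (N1 * (z - y) * N2)))
  = (x' * a * b * ((z - x) * (N1 * N2))) * (y * x' - 1 + (y' * y) * x' * (z - y)).
  by ring.
rewrite eu mul1r.
transitivity ((x' * a * b * ((z - x) * (N1 * N2))) * (x' * z - x' * x)).
  by rewrite e1; ring.
by ring.
Qed.

Lemma rec_coef_prod mu n i u v : (0 < i <= n.+1)%N -> (0 < v)%N ->
  let M w := \prod_(1 <= j < w.+1) (1 - E (mu i - mu j)) in
  \sum_(w < n.+1) (-1) ^+ (u + v + w) * rec_coef mu u v w * M w = M u * M v.
Proof.
move=> hi v0 M; have pn k : M k = _ := prod_newton mu k (mu i).
have := rec_coef_newton mu u hi v0; rewrite ED !pn.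
set z := E (mu i); set X := E (- wsum mu u); set Y := E (- wsum mu v).
set N1 := newton _ u z; set N2 := newton _ v z => h.
transitivity ((-1) ^+ (u + v) * (X * Y * (N1 * N2))).
  rewrite -h mulr_sumr; apply: eq_bigr => w _; rewrite pn (exprD _ (u + v)).
  set s := _ ^+ w; have ss : s * s = 1 by rewrite -expr2 sqrr_sign.
  by rewrite -[RHS]mul1r -ss; ring.
by rewrite exprD; ring.
Qed.

End Recursion.

(** * Comparison of the structure constants with the recursion *)

Section Weyl.
Variable n : nat.

Lemma denom_below (i w : 'I_n.+1) : denom i [set j : 'I_n.+1 | (j < w)%N] =
  \prod_(1 <= j < w.+1) (1 - grexp (eps n i.+1 - eps n j)).
Proof.
rewrite big_add1 big_mkord /= /denom.
rewrite (big_ord_widen n.+1 (fun j => 1 - grexp (eps n i.+1 - eps n j.+1))); last first.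
  by rewrite ltnW.
by apply: eq_bigl => j; rewrite inE.
Qed.

Lemma rec_coef_formula (mu : nat -> weight n) (u v w : nat) : (0 < v)%N ->
  let mu' := fun i => mu i.+1 in
  rec_coef (@grexp (weight n)) mu u v w =
    (grexp (mu u.+1 - mu 1%N) - 1)
      * rtilde_formula mu' (u%:Z - 1) (v%:Z - 1) (w%:Z - 1)
    + grexp (mu u.+1 - mu 1%N)
      * rtilde_formula mu' u%:Z (v%:Z - 1) (w%:Z - 1).
Proof.
have predS (k : nat) : k.+1%:Z - 1 = k%:Z by rewrite -addn1 PoszD addrK.
have pred0 : 0%:Z - 1 = Negz 0 by [].
move=> v0 mu'; move eu : (u%:Z - 1) => u'; move ev : (v%:Z - 1) => v'.
move ew : (w%:Z - 1) => w'.
case: v v0 ev => [|v] v0 ev; first discriminate v0.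
rewrite predS in ev; subst v'.
(* An index 0 becomes [Negz 0], where [rtilde_formula] returns 0 as [rec_coef] does; in each case
   the two sides are convertible. *)
case: u eu => [|u] eu; rewrite ?pred0 ?predS in eu; subst u';
  case: w ew => [|w] ew; rewrite ?pred0 ?predS in ew; subst w'; exact: erefl.
Qed.

Lemma rconst_denom (C : numFieldType) b (i u v : 'I_n.+1) : @structure_constants C n b ->
  \sum_w rconst b u v w * denom i [set j : 'I_n.+1 | (j < w)%N] =
  denom i [set j : 'I_n.+1 | (j < u)%N] * denom i [set j : 'I_n.+1 | (j < v)%N].
Proof.
move=> hb; have := congr1 (@wo n)
  (fixclass_structure (rev_ord i) hb (rev_ord u) (rev_ord v)).
rewrite woM wo_sum (wo_fixclass i u) (wo_fixclass i v) => <-.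
rewrite [RHS](reindex_inj rev_ord_inj); apply: eq_bigr => w _.
by rewrite woM wo_fixclass.
Qed.

(** Up to the sign, both sides solve the system of [rconst_denom], by [rec_coef_prod] for the right
    one, and [denom_triangular] makes the solution unique. *)
Lemma rtilde_rec_coef (C : numFieldType) b (u v w : 'I_n.+1) :
  @structure_constants C n b -> (0 < v)%N ->
  rtilde b u v w = rec_coef (@grexp (weight n)) (eps n) u v w.
Proof.
move=> hb v0; pose E := @grexp (weight n).
have E0 : E 0 = 1 by [].
have ED : forall x y, E (x + y) = E x * E y by apply: grexpD.
suff h : rconst b u v w = (-1) ^+ (u + v + w) * rec_coef E (eps n) u v w.
  by rewrite /rtilde h mulrA -expr2 sqrr_sign mul1r.
apply/eqP; rewrite -subr_eq0; apply/eqP; move: w.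
apply: denom_triangular => i.
under eq_bigr do rewrite mulrBl.
rewrite sumrB; apply/eqP; rewrite subr_eq0; apply/eqP.
apply: etrans (rconst_denom i u v hb) _.
have hi : (0 < i.+1 <= n.+1)%N by rewrite ltn_ord.
apply: etrans (etrans (esym (rec_coef_prod E0 ED (eps n) u hi v0)) _).
  by congr (_ * _); apply: denom_below.
by apply: eq_bigr => w _; congr (_ * _); apply/esym/denom_below.
Qed.

End Weyl.

Theorem theorem6p17 (R : realType) (n : nat)
    (b : 'I_n.+1 -> 'I_n.+1 -> 'I_n.+1 -> RT n)
    (hb : @structure_constants R[i] n b)
    (u v w : 'I_n.+1) (hv : (1 <= v)%N) :
  let eps' := fun i : nat => eps n i.+1 in
  rtilde b u v w =
    (grexp (eps n u.+1 - eps n 1) - 1)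
      * rtilde_formula eps' (u%:Z - 1) (v%:Z - 1) (w%:Z - 1)
    + grexp (eps n u.+1 - eps n 1)
      * rtilde_formula eps' u%:Z (v%:Z - 1) (w%:Z - 1).
Proof.
rewrite /= (rtilde_rec_coef u w hb hv).
have h := rec_coef_formula (eps n) u w hv; exact h.
Qed.
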